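(* Let $\Omega=\Omega_1\times\cdots\times\Omega_N$ with each $\Omega_k$ finite or countably infinite, and let $\mu$ be a probability measure on $\Omega$ with $\mu(x)>0$ for all $x\in\Omega$. Suppose that the heat bath semigroup of $\mu$ satisfies $\lim_{t\to\infty}\mathrm{Ent}_\mu(e^{t\mathcal L}f)=0$ for every bounded $f:\Omega\to[0,\infty)$, and that $\gamma+\kappa<1$, where, with the coefficients $\alpha_{i,k},\delta_{i,k}$ defined in the context, $$\gamma=\max_i\sum_{k:\,k\ne i}|\alpha_{i,k}\alpha_{k,i}-1|,\qquad \kappa=\frac14\max_i\sum_{k:\,k\ne i}(\delta_{k,i}+\delta_{i,k})\,\alpha_{i,k}\alpha_{k,i}.$$ Let $C=(1-\gamma-\kappa)^{-1}$. Then for any cover $\mathcal B$ of $[N]$, setting $\Delta(\mathcal B)=\max\{|B|:B\in\mathcal B\}$, for every bounded $f:\Omega\to[0,\infty)$ $$\mathrm{Ent}_\mu(f)\le C\,\frac{\Delta(\mathcal B)}{n_-(\mathcal B)}\sum_{B\in\mathcal B}\mu\big[\mathrm{Ent}_{\mu_B}(f)\big].$$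
   Context: Notation: $[N]=\{1,\dots,N\}$; $\mu[f]$ is the expectation of $f$ under $\mu$; $\mathrm{Ent}_\mu(f)=\mu[f\log f]-\mu[f]\log\mu[f]$ (with $0\log0=0$). A cover $\mathcal B$ of $[N]$ is a family of subsets $B\subset[N]$ whose union is $[N]$. $\deg_k(\mathcal B)$ is the number of $B\in\mathcal B$ with $k\in B$, and $n_-(\mathcal B)=\min_{k\in[N]}\deg_k(\mathcal B)$. For $B\subset[N]$, $\mu_B=\mu(\cdot\mid x_j,\ j\in B^c)$ is the conditional probability given the coordinates outside $B$, and $\mathrm{Ent}_{\mu_B}(f)$ is the function $\mu_B[f\log f]-\mu_B[f]\log\mu_B[f]$; $\mu_k=\mu_{\{k\}}$. Heat bath semigroup: $(e^{t\mathcal L})_{t\ge0}$ is the Markov semigroup with bounded generator $\mathcal Lf=\sum_{k=1}^N(\mu_k[f]-f)$. Coefficients: for $\bar x_k=(x_j)_{j\ne k}$ let $\mu_k^{\bar x_k}(x_k)=\mu(x_k,\bar x_k)/\sum_{y_k\in\Omega_k}\mu(y_k,\bar x_k)$. For $i\ne k$ let $\bar x_{i,k}=(x_j)_{j\ne i,k}\in\bar\Omega_{i,k}=\prod_{j\ne i,k}\Omega_j$, write $\mu_k^{x_i,\bar x_{i,k}}$ for $\mu_k^{\bar x_k}$ with $\bar x_k=(x_i,\bar x_{i,k})$, and set $$\phi_{i,k}(x_i,y_i,x_k,\bar x_{i,k})=\frac{\mu_k^{x_i,\bar x_{i,k}}(x_k)}{\mu_k^{y_i,\bar x_{i,k}}(x_k)},\qquad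 \alpha_{i,k}=\sup_{x_i,y_i,x_k,\bar x_{i,k}}\phi_{i,k}(x_i,y_i,x_k,\bar x_{i,k}),$$ $$\delta_{i,k}=\sup_{x_i,y_i,x_k,y_k,\bar x_{i,k}}\big|\phi_{i,k}(x_i,y_i,x_k,\bar x_{i,k})-\phi_{i,k}(x_i,y_i,y_k,\bar x_{i,k})\big|,$$ with suprema over $x_i,y_i\in\Omega_i$, $x_k,y_k\in\Omega_k$, $\bar x_{i,k}\in\bar\Omega_{i,k}$. *)

(* Defs.v *)
From HB Require Import structures.
From mathcomp Require Import all_boot all_order all_algebra.
From mathcomp Require Import all_classical all_reals all_analysis.
Import Order.TTheory GRing.Theory Num.Theory.
Import numFieldNormedType.Exports.

Set Implicit Arguments.
Unset Strict Implicit.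
Unset Printing Implicit Defensive.

Local Open Scope classical_set_scope.
Local Open Scope ring_scope.

(* Omega_1 x ... x Omega_N. The base points that [pointedType] provides are not
   used: they only make the product a [measurableType]. *)
Definition config (N : nat) (Om : 'I_N -> pointedType) : Type :=
  forall i : 'I_N, Om i.

HB.instance Definition _ (N : nat) (Om : 'I_N -> pointedType) :=
  Pointed.copy (config Om) (forall i : 'I_N, Om i).

HB.instance Definition _ (N : nat) (Om : 'I_N -> pointedType) :=
  @isMeasurable.Build default_measure_display (config Om)
    discrete_measurable discrete_measurable0
    discrete_measurableC discrete_measurableU.

Lemma measurable_config (N : nat) (Om : 'I_N -> pointedType)
  (A : set (config Om)) : measurable A.
Proof. by []. Qed.

(* [ln 0 = 0] in the library, in accordance with 0 log 0 = 0. *)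
Definition Ent d (T : measurableType d) (R : realType) (m : probability T R)
    (f : T -> R) : R :=
  \int[m]_x (f x * ln (f x)) - (\int[m]_x f x) * ln (\int[m]_x f x).

Section HeatBath.
Variables (R : realType) (N : nat) (Om : 'I_N -> pointedType).
Variable mu : probability (config Om) R.

Definition agree_off (B : {set 'I_N}) (x : config Om) : set (config Om) :=
  [set y | forall j, j \notin B -> y j = x j].

(* [cond_on B x] is mu_B = mu( . | x_j, j \notin B). The second argument of
   [mnormalize] is only used if the conditioning event has probability zero,
   which cannot happen if mu is everywhere positive. *)
Definition cond_on (B : {set 'I_N}) (x : config Om) : probability (config Om) R :=
  mnormalize (mrestr mu (measurable_config (agree_off B x))) mu.

Definition heat_bath_gen (f : config Om -> R) (x : config Om) : R :=
  \sum_(k < N) (\int[cond_on [set k]%SET x]_y f y - f x).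

(* The exponential series of the bounded operator [heat_bath_gen]; for bounded
   [f] it converges uniformly, hence its sum can be taken pointwise. *)
Definition heat_bath_semigroup (t : R) (f : config Om -> R) (x : config Om) : R :=
  limn (series (fun n : nat => t ^+ n / n`!%:R * iter n heat_bath_gen f x)).

Definition mass (x : config Om) : R := fine (mu [set x]).

Definition upd (x : config Om) (k : 'I_N) (a : Om k) : config Om := dfwith x k a.

(* mu_k^{x}(a): it does not depend on the coordinate [x k]. *)
Definition local_spec (k : 'I_N) (x : config Om) (a : Om k) : R :=
  mass (upd x a) / fine (\esum_(b in [set: Om k]) (mass (upd x b))%:E)%E.

(* The remaining coordinates are read off a full configuration [z], whose
   coordinates [i] and [k] are irrelevant when [i != k]. *)
Definition phi (i k : 'I_N) (xi yi : Om i) (xk : Om k) (z : config Om) : R :=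
  local_spec (upd z xi) xk / local_spec (upd z yi) xk.

Definition alpha (i k : 'I_N) : \bar R :=
  ereal_sup [set r | exists (xi yi : Om i) (xk : Om k) (z : config Om),
                       r = (phi xi yi xk z)%:E].

Definition delta (i k : 'I_N) : \bar R :=
  ereal_sup [set r | exists (xi yi : Om i) (xk yk : Om k) (z : config Om),
                       r = (`| phi xi yi xk z - phi xi yi yk z |)%:E].

Definition gamma : \bar R :=
  \big[maxe/-oo%E]_(i < N)
    (\sum_(k < N | k != i) `| alpha i k * alpha k i - 1 |)%E.

Definition kappa : \bar R :=
  ((4^-1)%:E *
   \big[maxe/-oo]_(i < N)
     \sum_(k < N | k != i) (delta k i + delta i k) * (alpha i k * alpha k i))%E.

End HeatBath.

(* Families of subsets are sequences: repetitions are allowed and counted. *)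
Definition is_cover (N : nat) (Bs : seq {set 'I_N}) : Prop :=
  (\bigcup_(B <- Bs) B = [set: 'I_N])%SET.

Definition cover_deg (N : nat) (Bs : seq {set 'I_N}) (k : 'I_N) : nat :=
  count (fun B : {set 'I_N} => k \in B) Bs.

(* [size Bs] bounds all degrees, so for [0 < N] this is their minimum. *)
Definition min_deg (N : nat) (Bs : seq {set 'I_N}) : nat :=
  \big[minn/size Bs]_(k < N) cover_deg Bs k.

Definition max_block (N : nat) (Bs : seq {set 'I_N}) : nat :=
  (\max_(B <- Bs) #|B|)%N.

(* Main.v *)
(* Entropy is dissipated along the heat bath semigroup f_t at rate sum_k D_k(f_t),
   where D_k(f) = mu[(f - mu_k f) log f], and one compares this with the decay of
   sum_k mu[Ent_k f_t].  Up to the terms i = k, which give - sum_k D_k, the time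
   derivative of the latter is the sum over i <> k of
     T_ik = mu[(mu_i f - f) log (f / mu_k f)],
   and T_ik <= (alpha_ki - 1) (D_i + D_k): replace f(x), for x and y differing in
   the coordinate i only, by its average u(x,y) over the coordinate k with weights
   mu_k(.) mu_i(y_i | .), which lowers D_i by joint convexity of
   (a - b)(log a - log b) and leaves as a bound for T_ik a term with the factor
   log (u / mu_k f), which is small because the weights vary by a factor of at most
   alpha_ki.  As (alpha_ik - 1) + (alpha_ki - 1) <= alpha_ik alpha_ki - 1, summation
   gives a total of at most gamma sum_k D_k; kappa only enlarges the constant C.
   Hence sum_k mu[Ent_k f_t] - (1 - gamma) Ent f_t is nonincreasing in t, and its
   value at t = 0 is nonnegative because Ent f_t tends to 0.  To avoid derivatives,
   the monotonicity is proved with an error O(s^2) for one Euler step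
   f + s L f, and f_t is the limit of (1 + t L / n)^n f.  Functions that vanish
   somewhere are approximated by f + s^2. *)
Require Import Defs.
From HB Require Import structures.
From mathcomp Require Import all_boot all_order all_algebra.
From mathcomp Require Import all_classical all_reals all_analysis.
From mathcomp Require Import ring lra.
Import Order.TTheory GRing.Theory Num.Theory.
Import numFieldNormedType.Exports.

Set Implicit Arguments.
Unset Strict Implicit.
Unset Printing Implicit Defensive.

Local Open Scope classical_set_scope.
Local Open Scope ring_scope.

(** * Inequalities for the logarithm *)

Section RealInequalities.
Variable R : realType.
Implicit Types a b p q t s : R.

(** This is [ln t <= t - 1] at [t = q / p], scaled by [p]; the tangent and Gibbs-type inequalities
    below reduce to it. *)
Lemma ln_ratio_le p q : 0 < p -> 0 < q -> p * (ln q - ln p) <= q - p.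
Proof.
move=> p0 q0; rewrite -ln_div ?posrE//.
have h : ln (q / p) <= q / p - 1.
  have := @le_ln1Dx R (q / p - 1); rewrite addrCA subrr addr0; apply.
  by rewrite ltrBrDr addrC subrr divr_gt0.
apply: le_trans (ler_wpM2l (ltW p0) h) _.
by rewrite mulrBr mulr1 mulrCA divff ?gt_eqF// mulr1.
Qed.

(* [2 (v - 1) / (v + 1)] is the first term of the artanh series of [ln v]. *)
Lemma ln_ge_artanh (v : R) : 1 <= v -> 2 * (v - 1) / (v + 1) <= ln v.
Proof.
move=> v1.
pose g (x : R) : R := ln x - 2 * (x - 1) / (x + 1).
have dg (x : R) : 1 <= x -> is_derive x 1 g ((x - 1) ^+ 2 / (x * (x + 1) ^+ 2)).
  move=> x1; have x0 : 0 < x by lra.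
  have H := is_derive1_ln x0.
  have x10 : x + 1 != 0 by rewrite gt_eqF//; lra.
  have -> : g = (@ln R) - ((fun x : R => 2 * (x - 1)) * (fun x : R => (x + 1)^-1)).
    by apply/funext => y.
  apply: is_derive_eq.
  rewrite -!/(GRing.scale _ _) /GRing.scale /=.
  by field; rewrite x10 gt_eqF.
have : g 1 <= g v.
  apply: (@ger0_derive1_ndecry R g 1) => //.
  - by move=> x; rewrite in_itv/= andbT => x1; have [] := dg x (ltW x1).
  - move=> x; rewrite in_itv/= andbT => x1.
    rewrite derive1E (@derive_val _ _ _ _ _ _ _ (dg x (ltW x1))).
    by rewrite divr_ge0 ?sqr_ge0// mulr_ge0 ?sqr_ge0//; lra.
  - apply: derivable_within_continuous => x; rewrite in_itv/= andbT => x1.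
    by have [] := dg x x1.
by rewrite /g ln1 subrr mulr0 mul0r subr0 subr_ge0.
Qed.

(** Both sides are symmetric, so [b <= a] may be assumed; the bound is then [ln_ge_artanh] at
    [v = a / b]. *)
Lemma mul_sub_ln_ge a b : 0 < a -> 0 < b ->
  2 * (a - b) ^+ 2 / (a + b) <= (a - b) * (ln a - ln b).
Proof.
wlog ab : a b / b <= a.
  move=> H a0 b0; have [/H|/ltW/H] := leP b a; first exact.
  have -> : (a - b) * (ln a - ln b) = (b - a) * (ln b - ln a) by ring.
  by rewrite [a + b]addrC -(sqrrN (a - b)) opprB => /(_ b0 a0).
move=> a0 b0; rewrite -ln_div ?posrE//.
have v1 : 1 <= a / b by rewrite ler_pdivlMr// mul1r.
have -> : 2 * (a - b) ^+ 2 / (a + b) = (a - b) * (2 * (a / b - 1) / (a / b + 1)).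
  by field; rewrite !gt_eqF ?addr_gt0.
by apply: ler_wpM2l; [rewrite subr_ge0 | exact: ln_ge_artanh].
Qed.

Lemma mul_sub_ln_ge0 a b : 0 < a -> 0 < b -> 0 <= (a - b) * (ln a - ln b).
Proof.
move=> a0 b0; apply: le_trans (mul_sub_ln_ge a0 b0).
apply: divr_ge0; last by rewrite ltW// addr_gt0.
by apply: mulr_ge0 => //; exact: sqr_ge0.
Qed.

(** The two signs of [ln a - ln b] need the deviation relative to [a] and relative to [b]
    respectively, hence two hypotheses. *)
Lemma abs_ln_sub_le a b t : 0 < a -> 0 < b ->
  `|a - b| <= t * a -> `|a - b| <= t * b -> `|ln a - ln b| <= t.
Proof.
move=> a0 b0 h1 h2.
have e1 := ln_ratio_le a0 b0; have e2 := ln_ratio_le b0 a0.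
rewrite ler_norml; apply/andP; split.
- rewrite -(ler_pM2l a0); have := ler_norm (b - a); rewrite distrC; nra.
- rewrite -(ler_pM2l b0); have := ler_norm (a - b); nra.
Qed.

(** Completing the square would give an error proportional to [(u + v) * th ^+ 2]. Only [u] may
    appear here, because later [u * th ^+ 2] alone is controlled; [th <= 1] pays for this when [v]
    exceeds [u]. *)
Lemma mul_abs_le_quad (u v th : R) : 0 < u -> 0 < v -> 0 <= th <= 1 ->
  `|u - v| * th <= (u - v) ^+ 2 / (u + v) + 2 * u * th ^+ 2.
Proof.
move=> u0 v0 /andP[th0 th1].
have uv : 0 < u + v by rewrite addr_gt0.
rewrite -(ler_pM2r uv) [leRHS]mulrDl divfK ?gt_eqF//.
rewrite -[(u - v) ^+ 2]real_normK ?num_real//.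
have [uv'|/ltW uv'] := leP v u.
- rewrite ger0_norm ?subr_ge0//.
  set w := u - v; have w0 : 0 <= w by rewrite /w subr_ge0.
  have wu : w <= u by rewrite /w; lra.
  have -> : u + v = 2 * u - w by rewrite /w; ring.
  have h : 0 <= w ^+ 2 + 2 * u ^+ 2 * th ^+ 2 - 2 * u * w * th.
    have : 0 <= (w - u * th) ^+ 2 by exact: sqr_ge0.
    have : 0 <= (u * th) ^+ 2 by exact: sqr_ge0.
    by nra.
  have h2 : 2 * u ^+ 2 * th ^+ 2 <= 2 * u * th ^+ 2 * (2 * u - w).
    have -> : 2 * u * th ^+ 2 * (2 * u - w) =
      2 * u ^+ 2 * th ^+ 2 + (2 * u * th ^+ 2) * (u - w) by ring.
    by rewrite lerDl mulr_ge0 ?subr_ge0// !mulr_ge0 ?sqr_ge0// ltW.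
  have h3 : 0 <= w * th * w by rewrite !mulr_ge0.
  by nra.
- rewrite distrC ger0_norm ?subr_ge0//.
  set w := v - u; have w0 : 0 <= w by rewrite /w subr_ge0.
  have -> : u + v = 2 * u + w by rewrite /w; ring.
  rewrite -subr_ge0.
  have -> : w ^+ 2 + 2 * u * th ^+ 2 * (2 * u + w) - w * th * (2 * u + w) =
    (1 - th) * ((w - u * th) ^+ 2) + (th * u) ^+ 2 * (3 + th) by ring.
  by rewrite addr_ge0// mulr_ge0 ?sqr_ge0 ?subr_ge0//; lra.
Qed.

End RealInequalities.

(** * Expectations on a countable product space *)

Section Bounded.
Variable R : realType.

Definition bdd (T : Type) (f : T -> R) := exists K, forall x, `|f x| <= K.

Lemma bdd_cst (T : Type) (c : R) : bdd (fun _ : T => c).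
Proof. by exists `|c|. Qed.

Lemma bddD (T : Type) (f g : T -> R) : bdd f -> bdd g -> bdd (fun x => f x + g x).
Proof.
by move=> [K hK] [L hL]; exists (K + L) => x; apply: le_trans (ler_normD _ _) (lerD _ _).
Qed.

Lemma bddN (T : Type) (f : T -> R) : bdd f -> bdd (fun x => - f x).
Proof. by move=> [K hK]; exists K => x; rewrite normrN. Qed.

Lemma bddM (T : Type) (f g : T -> R) : bdd f -> bdd g -> bdd (fun x => f x * g x).
Proof.
by move=> [K hK] [L hL]; exists (K * L) => x; rewrite normrM ler_pM.
Qed.

Lemma bddX (T : Type) (f : T -> R) n : bdd f -> bdd (fun x => f x ^+ n).
Proof.
by move=> [K hK]; exists (K ^+ n) => x; rewrite normrX lerXn2r// nnegrE; exact: le_trans (hK x).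
Qed.

Lemma bdd_norm (T : Type) (f : T -> R) : bdd f -> bdd (fun x => `|f x|).
Proof. by move=> [K hK]; exists K => x; rewrite normr_id. Qed.

Lemma bdd_sum (T I : Type) (r : seq I) (P : pred I) (f : I -> T -> R) :
  (forall i, bdd (f i)) -> bdd (fun x => \sum_(i <- r | P i) f i x).
Proof.
move=> h; elim: r => [|a r [K hK]].
  by exists 0 => x; rewrite big_nil normr0.
have [L hL] := h a; exists (`|L| + K) => x; rewrite big_cons.
case: ifP => _; last by apply: le_trans (hK x) _; rewrite lerDr.
by apply: le_trans (ler_normD _ _) (lerD _ _) => //; apply: le_trans (hL x) (ler_norm _).
Qed.

Lemma bdd_comp (S T : Type) (f : T -> R) (g : S -> T) : bdd f -> bdd (fun x => f (g x)).
Proof. by move=> [K hK]; exists K. Qed.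

Lemma bdd_itv (T : Type) (f : T -> R) (a b : R) : (forall x, a <= f x <= b) -> bdd f.
Proof.
move=> h; exists (`|a| + `|b|) => x; have /andP[h1 h2] := h x.
rewrite ler_norml; have := ler_norm b; have := ler_norm (- a); rewrite normrN.
by have := normr_ge0 a; have := normr_ge0 b; lra.
Qed.

Lemma ln_itv (a b t : R) : 0 < a -> a <= t <= b -> ln a <= ln t <= ln b.
Proof.
move=> a0 /andP[h1 h2]; have t0 := lt_le_trans a0 h1.
by rewrite !ler_ln ?posrE// ?h1//; apply: lt_le_trans h2.
Qed.

Lemma bdd_ln (T : Type) (f : T -> R) (a b : R) : 0 < a -> (forall x, a <= f x <= b) ->
  bdd (fun x => ln (f x)).
Proof. by move=> a0 h; apply: (@bdd_itv _ _ (ln a) (ln b)) => x; exact: ln_itv. Qed.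

Lemma bdd_inv (T : Type) (f : T -> R) (a b : R) : 0 < a -> (forall x, a <= f x <= b) ->
  bdd (fun x => (f x)^-1).
Proof.
move=> a0 h; apply: (@bdd_itv _ _ 0 a^-1) => x; have /andP[h1 h2] := h x.
have t0 := lt_le_trans a0 h1.
by rewrite invr_ge0 ltW//= lef_pV2 ?posrE.
Qed.

Lemma bdd_fun_bounded (T : Type) (f : T -> R) : bounded_fun f -> bdd f.
Proof.
move=> [K [_ /(_ (`|K| + 1))]].
have -> : K < `|K| + 1 by rewrite (le_lt_trans (ler_norm K))// ltrDl.
by move=> /(_ isT) h; exists (`|K| + 1) => x; exact: h.
Qed.

Lemma bounded_fun_bdd (T : Type) (f : T -> R) : bdd f -> bounded_fun f.
Proof.
move=> [K hK]; exists K; split; first exact: num_real.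
by move=> L KL x _; apply: le_trans (hK x) (ltW KL).
Qed.

End Bounded.

(* Comparing hypotheses by unfolding integrals would be expensive, hence the
   syntactic test. *)
Ltac bd_hyp := match goal with H : @bdd _ ?T ?f |- bdd ?g =>
  let f' := eval cbv beta in (fun x : T => f x) in
  let g' := eval cbv beta in (fun x : T => g x) in
  constr_eq f' g'; exact H end.

Ltac bd := cbv beta; first [bd_hyp | lazymatch goal with
  | |- bdd (fun _ => ?c) => exact (bdd_cst _ c)
  | |- bdd (fun x => @?f x + @?g x) => apply (@bddD _ _ f g); bd
  | |- bdd (fun x => - @?f x) => apply (@bddN _ _ f); bd
  | |- bdd (fun x => @?f x * @?g x) => apply (@bddM _ _ f g); bd
  | |- bdd (fun x => @?f x ^+ ?n) => apply (@bddX _ _ f n); bd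
  | |- bdd (fun x => `| @?f x |) => apply (@bdd_norm _ _ f); bd
  | |- _ => with_strategy opaque [Rintegral ln] assumption
  end].

(** * Calculus of expectations of bounded functions, and Fubini through sums over points *)

Section Expectation.
Variables (R : realType) (N : nat) (Om : 'I_N -> pointedType).
Implicit Types (m : probability (config Om) R) (f g : config Om -> R).

Lemma bdd_integrable m f : bdd f -> m.-integrable [set: config Om] (EFin \o f).
Proof.
move=> fb; apply: measurable_bounded_integrable => //.
- by apply: le_lt_trans (probability_le1 m measurableT) (ltry _).
- exact: bounded_fun_bdd.
Qed.


Lemma ExpD m f g : bdd f -> bdd g ->
  \int[m]_x (f x + g x) = \int[m]_x f x + \int[m]_x g x.
Proof. by move=> fb gb; rewrite RintegralD//; exact: bdd_integrable. Qed.

Lemma ExpB m f g : bdd f -> bdd g ->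
  \int[m]_x (f x - g x) = \int[m]_x f x - \int[m]_x g x.
Proof. by move=> fb gb; rewrite RintegralB//; exact: bdd_integrable. Qed.

Lemma ExpZl m c f : bdd f -> \int[m]_x (c * f x) = c * \int[m]_x f x.
Proof. by move=> fb; rewrite RintegralZl//; exact: bdd_integrable. Qed.

Lemma ExpZr m c f : bdd f -> \int[m]_x (f x * c) = \int[m]_x f x * c.
Proof. by move=> fb; rewrite RintegralZr//; exact: bdd_integrable. Qed.

Lemma ExpN m f : bdd f -> \int[m]_x (- f x) = - \int[m]_x f x.
Proof.
move=> fb; rewrite -mulN1r -ExpZl//.
by apply: eq_Rintegral => x _; rewrite mulN1r.
Qed.

Lemma Exp_cst m c : \int[m]_x c = c.
Proof.
rewrite Rintegral_cst// -[RHS]mulr1; congr (_ * _).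
by rewrite -[RHS]/(fine 1%E); congr fine; exact: probability_setT.
Qed.

Lemma Exp_le m f g : bdd f -> bdd g -> (forall x, f x <= g x) ->
  \int[m]_x f x <= \int[m]_x g x.
Proof. by move=> fb gb h; apply: le_Rintegral => // ; exact: bdd_integrable. Qed.

Lemma Exp_ge0 m f : (forall x, 0 <= f x) -> 0 <= \int[m]_x f x.
Proof. by move=> h; apply: Rintegral_ge0. Qed.

Lemma Exp_eq m f g : (forall x, f x = g x) -> \int[m]_x f x = \int[m]_x g x.
Proof. by move=> h; apply: eq_Rintegral => x _. Qed.

Lemma Exp_itv m f a b : (forall x, a <= f x <= b) -> a <= \int[m]_x f x <= b.
Proof.
move=> h; have fb := bdd_itv h.
apply/andP; split; [rewrite -[leLHS](Exp_cst m)|rewrite -[leRHS](Exp_cst m)].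
- by apply: Exp_le => [||x]; [bd|bd|case/andP: (h x)].
- by apply: Exp_le => [||x]; [bd|bd|case/andP: (h x)].
Qed.

Lemma Exp_sum m (I : Type) (r : seq I) (P : pred I) (f : I -> config Om -> R) :
  (forall i, bdd (f i)) ->
  \int[m]_x (\sum_(i <- r | P i) f i x) = \sum_(i <- r | P i) \int[m]_x f i x.
Proof.
move=> h; elim: r => [|a r IH].
  by under Exp_eq do rewrite big_nil; rewrite big_nil Exp_cst.
under Exp_eq do rewrite big_cons; rewrite big_cons.
by case: ifP => _ //; rewrite -IH -ExpD//; exact: bdd_sum.
Qed.

Lemma Exp_norm_le m f K : (forall x, `|f x| <= K) -> `|\int[m]_x f x| <= K.
Proof.
move=> h; rewrite ler_norml; apply: Exp_itv => x.
by rewrite -ler_norml.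
Qed.

Lemma bdd_Exp (S : Type) (m : S -> probability (config Om) R) (f : S -> config Om -> R) :
  bdd (fun p => f p.1 p.2) -> bdd (fun s => \int[m s]_y f s y).
Proof.
move=> [K hK]; exists K => s; apply: Exp_norm_le => x.
exact: (hK (s, x)).
Qed.

Hypothesis hOm : forall k : 'I_N, countable [set: Om k].

(** A finite product of countable types embeds into finite functions to [nat], which [pickle]
    encodes. Countability turns every expectation into a sum over points. *)
Lemma countable_config : countable [set: config Om].
Proof.
have inj k : exists g : Om k -> nat, injective g.
  have /countable_injP[g hg] := hOm k.
  by exists g => x y; apply: hg; rewrite inE.
pose g k := projT1 (cid (inj k)).
have hg k : injective (g k) := projT2 (cid (inj k)).
apply/countable_injP.
exists (fun x => pickle [ffun i => g i (x i)]) => x y _ _ /(pcan_inj pickleK) /ffunP h.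
by apply: functional_extensionality_dep => i; apply: (hg i); have := h i; rewrite !ffunE.
Qed.

Definition pmass m (x : config Om) : R := fine (m [set x]).

Lemma pmass_ge0 m x : 0 <= pmass m x.
Proof. exact: fine_ge0. Qed.

Lemma EFin_pmass m x : (pmass m x)%:E = m [set x].
Proof. by rewrite /pmass fineK// fin_num_measure. Qed.

(** The fibres of an injection into [nat] are empty or singletons, so countable additivity of the
    integral over them gives the sum. *)
Lemma integral_esum m f : (forall x, 0 <= f x) ->
  (\int[m]_x (f x)%:E = \esum_(x in [set: config Om]) (f x * pmass m x)%:E)%E.
Proof.
move=> f0; have /countable_injP[g hg] := countable_config.
pose F n := [set x : config Om | g x = n].
have FT : [set: config Om] = \bigcup_n F n.
  by apply/seteqP; split => // x _; exists (g x).
have tF : trivIset [set: nat] F.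
  by move=> i j _ _ [x [<- <-]].
rewrite FT ge0_integral_bigcup//; last by move=> x _; rewrite lee_fin.
rewrite nneseries_sum_bigcup//; last by move=> x; rewrite lee_fin mulr_ge0// pmass_ge0.
apply: eq_eseriesr => n _.
have [->|/set0P[x /= xn]] := eqVneq (F n) set0.
  by rewrite integral_set0 esum_set0.
have -> : F n = [set x].
  by apply/seteqP; split => [y /= yn|y /= ->//]; apply: hg; rewrite ?inE// yn.
rewrite esum_set1; last by rewrite lee_fin mulr_ge0// pmass_ge0.
rewrite EFinM EFin_pmass -integral_cst//; first by apply: eq_integral => y /[!inE] ->.
Qed.

Lemma Exp_esum m f : bdd f -> (forall x, 0 <= f x) ->
  (\int[m]_x f x)%:E = (\esum_(x in [set: config Om]) (f x * pmass m x)%:E)%E.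
Proof.
move=> fb f0; rewrite -integral_esum// /Rintegral fineK//.
by apply: integrable_fin_num => //; exact: (bdd_integrable m fb).
Qed.

Lemma esum_exchange (T1 T2 : choiceType) (a : T1 -> T2 -> \bar R) :
  (forall x y, 0 <= a x y)%E ->
  (\esum_(x in [set: T1]) \esum_(y in [set: T2]) a x y =
   \esum_(y in [set: T2]) \esum_(x in [set: T1]) a x y)%E.
Proof.
move=> a0; rewrite !esum_esum//.
rewrite (reindex_esum ([set: T2] `*`` (fun=> [set: T1])) _ (fun x => (x.2, x.1)))//.
by split=> //= [[x y] [x' y'] _ _ [-> ->]//|[x y] _]; exists (y, x).
Qed.

Lemma Exp2_esum m (kap : config Om -> probability (config Om) R)
    (psi : config Om -> config Om -> R) :
  bdd (fun p => psi p.1 p.2) -> (forall x y, 0 <= psi x y) ->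
  (\int[m]_x \int[kap x]_y psi x y)%:E =
  (\esum_(x in [set: config Om]) \esum_(y in [set: config Om])
     (psi x y * (pmass m x * pmass (kap x) y))%:E)%E.
Proof.
move=> pb p0; rewrite Exp_esum; [|exact: bdd_Exp|by move=> x; exact: Exp_ge0].
apply: eq_esum => x _; rewrite -ExpZr; last exact: (bdd_comp (fun y => (x, y)) pb).
rewrite Exp_esum; first by apply: eq_esum => y _; rewrite mulrA.
  by apply: bddM; [exact: (bdd_comp (fun y => (x, y)) pb)|bd].
by move=> y; rewrite mulr_ge0// pmass_ge0.
Qed.

(** An exchange identity for nonnegative [psi] extends to bounded [psi]: apply it to [psi + K],
    where [K] bounds [psi], and cancel [K], since all measures have mass one. *)
Lemma Exp2_sign m m' (kap kap' : config Om -> probability (config Om) R) :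
  (forall psi, bdd (fun p => psi p.1 p.2) -> (forall x y, 0 <= psi x y) ->
    \int[m]_x \int[kap x]_y psi x y = \int[m']_x \int[kap' x]_y psi y x) ->
  forall psi, bdd (fun p => psi p.1 p.2) ->
    \int[m]_x \int[kap x]_y psi x y = \int[m']_x \int[kap' x]_y psi y x.
Proof.
move=> H psi pb; have [K hK] := pb.
have pb1 x : bdd (psi x) by exact: (bdd_comp (fun y => (x, y)) pb).
have pb2 x : bdd (psi^~ x) by exact: (bdd_comp (fun y => (y, x)) pb).
have pb' : bdd (fun p : config Om * config Om => psi p.2 p.1).
  exact: (bdd_comp (fun p => (p.2, p.1)) pb).
have := H (fun x y => psi x y + K).
rewrite (@Exp_eq m _ (fun x => \int[kap x]_y psi x y + K)); last first.
  by move=> x; rewrite ExpD ?Exp_cst//; bd.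
rewrite ExpD ?Exp_cst; [|exact: bdd_Exp|by bd].
rewrite (@Exp_eq m' (fun x => \int[kap' x]_y (psi y x + K))
  (fun x => \int[kap' x]_y psi y x + K)); last first.
  by move=> x; rewrite ExpD ?Exp_cst//; bd.
rewrite ExpD ?Exp_cst; [|exact: (@bdd_Exp _ kap' (fun x y => psi y x))|by bd].
move=> /(_ _ _)/addIr; apply; first by bd.
by move=> x y; have := hK (x, y); rewrite ler_norml -subr_ge0 opprK addrC => /andP[]; rewrite addrC.
Qed.

Lemma Exp_Fubini m m' (psi : config Om -> config Om -> R) :
  bdd (fun p => psi p.1 p.2) ->
  \int[m]_x \int[m']_y psi x y = \int[m']_x \int[m]_y psi y x.
Proof.
move: psi; apply: Exp2_sign => psi pb p0; apply: EFin_inj; rewrite Exp2_esum//.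
rewrite (@Exp2_esum m' (fun=> m) (fun x y => psi y x))//; last first.
  exact: (bdd_comp (fun p => (p.2, p.1)) pb).
rewrite esum_exchange; last by move=> x y; rewrite lee_fin !mulr_ge0 ?pmass_ge0.
by apply: eq_esum => x _; apply: eq_esum => y _; rewrite (mulrC (pmass m y)).
Qed.

End Expectation.

(** * Conditional expectations *)

Section Conditioning.
Variables (R : realType) (N : nat) (Om : 'I_N -> pointedType).
Hypothesis hOm : forall k : 'I_N, countable [set: Om k].
Variable mu : probability (config Om) R.
Hypothesis hmu : forall x : config Om, (0 < mu [set x])%E.
Implicit Types (B : {set 'I_N}) (f g : config Om -> R) (x y z : config Om).

Lemma agree_off_refl B x : agree_off B x x.
Proof. by []. Qed.

Lemma agree_off_sym B x y : agree_off B x y -> agree_off B y x.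
Proof. by move=> h j /h. Qed.

Lemma agree_offE B x y : agree_off B x y -> agree_off B y = agree_off B x.
Proof.
by move=> h; apply/seteqP; split=> z hz j jB; rewrite hz// h.
Qed.

Lemma agree_off_sub (A B : {set 'I_N}) x y : A \subset B -> agree_off A x y -> agree_off B x y.
Proof. by move=> AB h j jB; apply: h; apply: contra jB; apply: (fintype.subsetP AB). Qed.

Lemma upd_same x k (a : Om k) : upd x a k = a.
Proof. exact: dfwithin. Qed.

Lemma upd_other x k (a : Om k) j : j != k -> upd x a j = x j.
Proof. by move=> jk; rewrite /upd dfwithout// eq_sym. Qed.

Lemma agree_off_upd x k (a : Om k) : agree_off [set k]%SET x (upd x a).
Proof. by move=> j; rewrite finset.in_set1 => jk; exact: upd_other. Qed.

Lemma agree_off1E x k y : agree_off [set k]%SET x y -> y = upd x (y k).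
Proof.
move=> h; apply: functional_extensionality_dep => j.
have [->|jk] := eqVneq j k; first by rewrite upd_same.
by rewrite upd_other// h// finset.in_set1.
Qed.

Lemma pmass_gt0 x : 0 < pmass mu x.
Proof. by rewrite -lte_fin EFin_pmass. Qed.

Definition block_mass B x : R := fine (mu (agree_off B x)).

Lemma EFin_block_mass B x : (block_mass B x)%:E = mu (agree_off B x).
Proof. by rewrite /block_mass fineK// fin_num_measure//; exact: measurable_config. Qed.

Lemma block_mass_gt0 B x : 0 < block_mass B x.
Proof.
rewrite -lte_fin EFin_block_mass; apply: lt_le_trans (hmu x) _.
by apply: le_measure; rewrite ?inE// => y ->.
Qed.

(** Full support of [mu] gives the block positive mass, which excludes the default case of
    [mnormalize]. *)
Lemma cond_onE B x (A : set (config Om)) :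
  cond_on mu B x A = (mu (A `&` agree_off B x) * (block_mass B x)^-1%:E)%E.
Proof.
rewrite /cond_on /= /mnormalize /= /mrestr setTI -EFin_block_mass.
by rewrite orbF eqe gt_eqF ?block_mass_gt0//.
Qed.

Lemma cond_on_congr B x y : agree_off B x y -> cond_on mu B y = cond_on mu B x.
Proof. by move=> h; rewrite /cond_on (agree_offE h). Qed.

Lemma pmass_cond_on B x y : agree_off B x y ->
  pmass (cond_on mu B x) y = pmass mu y / block_mass B x.
Proof.
move=> h; apply: EFin_inj; rewrite EFin_pmass cond_onE EFinM EFin_pmass.
by congr (mu _ * _)%E; apply/seteqP; split=> [z []//|z ->].
Qed.

Lemma pmass_cond_on0 B x y : ~ agree_off B x y -> pmass (cond_on mu B x) y = 0.
Proof.
move=> h; apply: EFin_inj; rewrite EFin_pmass cond_onE.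
rewrite (_ : [set y] `&` _ = set0) ?measure0 ?mul0e//.
by apply/seteqP; split => // z [-> /h].
Qed.

Lemma cond_Exp_eq B x f g : bdd f -> bdd g -> (forall y, agree_off B x y -> f y = g y) ->
  \int[cond_on mu B x]_y f y = \int[cond_on mu B x]_y g y.
Proof.
move=> fb gb fg; apply/eqP; rewrite -subr_eq0 -ExpB// -normr_le0.
apply: le_trans (le_normr_Rintegral _ _) _ => //.
  by apply: (@bdd_integrable _ _ _ _ (fun y => f y - g y)); bd.
rewrite -lee_fin (Exp_esum hOm); [|by bd|by []].
rewrite esum1// => y _; have [h|h] := pselect (agree_off B x y).
  by rewrite fg// subrr normr0 mul0r.
by rewrite pmass_cond_on0// mulr0.
Qed.

Lemma cond_Exp_pull B x f g : bdd f -> bdd g ->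
  (forall y, agree_off B x y -> g y = g x) ->
  \int[cond_on mu B x]_y (g y * f y) = g x * \int[cond_on mu B x]_y f y.
Proof.
move=> fb gb gx; rewrite -ExpZl//; apply: cond_Exp_eq; [by bd|by bd|].
by move=> y /gx ->.
Qed.

(** The joint weight of [x] and [y] is [mu(x) mu(y)] divided by the mass of their common block, or
    zero if they lie in different blocks; this is symmetric. *)
Lemma cond_on_reversible B (psi : config Om -> config Om -> R) :
  bdd (fun p => psi p.1 p.2) ->
  \int[mu]_x \int[cond_on mu B x]_y psi x y = \int[mu]_x \int[cond_on mu B x]_y psi y x.
Proof.
move: psi; apply: Exp2_sign => psi pb p0; apply: EFin_inj; rewrite Exp2_esum//.
rewrite (@Exp2_esum _ _ _ hOm mu (cond_on mu B) (fun x y => psi y x))//; last first.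
  exact: (bdd_comp (fun p => (p.2, p.1)) pb).
rewrite esum_exchange; last by move=> x y; rewrite lee_fin !mulr_ge0 ?pmass_ge0.
apply: eq_esum => x _; apply: eq_esum => y _; congr (_ * _)%:E.
have [h|h] := pselect (agree_off B x y).
  rewrite !pmass_cond_on//; last exact: agree_off_sym.
  by rewrite /block_mass (agree_offE h) mulrCA.
by rewrite !pmass_cond_on0 ?mulr0// => /agree_off_sym.
Qed.

(** Reversibility turns [g x * f y] into [g y * f x], and [g] is constant on the block over which
    [y] is averaged. *)
Lemma cond_on_tower B f g : bdd f -> bdd g ->
  (forall x y, agree_off B x y -> g y = g x) ->
  \int[mu]_x (g x * \int[cond_on mu B x]_y f y) = \int[mu]_x (g x * f x).
Proof.
move=> fb gb gB.
rewrite (@Exp_eq _ _ _ mu _ (fun x => \int[cond_on mu B x]_y (g x * f y))); last first.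
  by move=> x; rewrite ExpZl.
rewrite (cond_on_reversible B (psi := fun x y => g x * f y)); last first.
  by apply: bddM; [exact: (bdd_comp fst)|exact: (bdd_comp snd)].
apply: Exp_eq => x; rewrite (cond_Exp_pull (g := g) (f := fun=> f x)) ?Exp_cst//.
  exact: bdd_cst.
exact: gB.
Qed.

Lemma Exp_cond_on B f : bdd f ->
  \int[mu]_x \int[cond_on mu B x]_y f y = \int[mu]_x f x.
Proof.
move=> fb; have := @cond_on_tower B f (fun=> 1) fb (bdd_cst _ _) (fun _ _ _ => erefl).
by under Exp_eq do rewrite mul1r; under [in RHS]Exp_eq do rewrite mul1r.
Qed.

Lemma measure_esum (A : set (config Om)) :
  mu A = (\esum_(x in A) (pmass mu x)%:E)%E.
Proof.
rewrite esum_mkcond -[in LHS](setIT A) -integral_indic//.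
rewrite (integral_esum hOm); last by move=> x; rewrite indicE ler0n.
apply: eq_esum => x _; rewrite indicE.
by case: ifPn => /= _; rewrite ?mul1r ?mul0r.
Qed.

Lemma upd_bij x k :
  set_bij [set: Om k] (agree_off [set k]%SET x) (fun b => upd x b).
Proof.
split => [b _|b c _ _ bc|y /agree_off1E ->]; first exact: agree_off_upd.
  by rewrite -(upd_same x b) bc upd_same.
by exists (y k).
Qed.

Lemma local_specE k x (b : Om k) :
  local_spec mu x b = pmass mu (upd x b) / block_mass [set k]%SET x.
Proof.
rewrite /local_spec /block_mass measure_esum; congr (_ / fine _).
by rewrite (reindex_esum _ _ _ _ (upd_bij x k)).
Qed.

Lemma local_spec_gt0 k x (b : Om k) : 0 < local_spec mu x b.
Proof. by rewrite local_specE divr_gt0// ?pmass_gt0// block_mass_gt0. Qed.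

Lemma local_spec_le1 k x (b : Om k) : local_spec mu x b <= 1.
Proof.
rewrite local_specE ler_pdivrMr ?block_mass_gt0// mul1r -lee_fin EFin_pmass EFin_block_mass.
by apply: le_measure; rewrite ?inE// => y ->; exact: agree_off_upd.
Qed.

Lemma cond_on1_esum k x f : bdd f -> (forall y, 0 <= f y) ->
  (\int[cond_on mu [set k]%SET x]_y f y)%:E =
  (\esum_(b in [set: Om k]) (f (upd x b) * local_spec mu x b)%:E)%E.
Proof.
move=> fb f0; rewrite (Exp_esum hOm)//.
transitivity (\esum_(y in agree_off [set k]%SET x) (f y * pmass (cond_on mu [set k]%SET x) y)%:E)%E.
  rewrite [RHS]esum_mkcond; apply: eq_esum => y _; case: ifPn => //.
  by rewrite notin_setE => h; rewrite pmass_cond_on0// mulr0.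
rewrite (reindex_esum _ _ _ _ (upd_bij x k)); apply: eq_esum => b _.
by rewrite pmass_cond_on ?local_specE//; exact: agree_off_upd.
Qed.

(** A change of measure from the law of coordinate [i] given [z] to the one given [x]; the factor is
    the density, and the bound [a] makes it integrable. Points of the two blocks are matched by
    their coordinate [i]. *)
Lemma cond_on1_change i x z f g (a : R) : bdd f -> bdd g ->
  (forall b : Om i, local_spec mu z b <= a * local_spec mu x b) ->
  (forall b : Om i, f (upd z b) = g (upd x b)) ->
  \int[cond_on mu [set i]%SET z]_y f y =
  \int[cond_on mu [set i]%SET x]_y (local_spec mu z (y i) / local_spec mu x (y i) * g y).
Proof.
move=> fb gb ha fg.
have p0 w (b : Om i) : 0 < local_spec mu w b by exact: local_spec_gt0.
have r0 (b : Om i) : 0 <= local_spec mu z b / local_spec mu x b.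
  by apply: divr_ge0; exact: ltW.
have rb : bdd (fun y : config Om => local_spec mu z (y i) / local_spec mu x (y i)).
  by apply: (@bdd_itv _ _ _ 0 a) => y; rewrite r0 /= ler_pdivrMr.
have key f' g' : bdd f' -> bdd g' -> (forall y, 0 <= f' y) -> (forall y, 0 <= g' y) ->
    (forall b : Om i, f' (upd z b) = g' (upd x b)) ->
    \int[cond_on mu [set i]%SET z]_y f' y =
    \int[cond_on mu [set i]%SET x]_y (local_spec mu z (y i) / local_spec mu x (y i) * g' y).
  move=> fb' gb' f0 g0 fg'; apply: EFin_inj; rewrite cond_on1_esum// cond_on1_esum; last 2 first.
  - by bd.
  - by move=> y; rewrite mulr_ge0.
  apply: eq_esum => b _; rewrite upd_same fg' mulrAC; congr (_%:E).
  by rewrite divfK ?gt_eqF// mulrC.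
have [K hK] : exists K, forall y, `|f y| <= K /\ `|g y| <= K.
  have [K1 h1] := fb; have [K2 h2] := gb; exists (Num.max K1 K2) => y.
  by rewrite !le_max h1 h2 orbT.
(* [key] settles nonnegative functions. It is applied to [f + K] and [g + K], then to the constant
   [K], and the results are subtracted. *)
have h1 : \int[cond_on mu [set i]%SET z]_y (f y + K) =
    \int[cond_on mu [set i]%SET x]_y (local_spec mu z (y i) / local_spec mu x (y i) * (g y + K)).
  apply: key; [by bd|by bd| | |by move=> b; rewrite fg].
  - by move=> y; have [] := hK y; rewrite ler_norml; lra.
  - by move=> y; have [] := hK y; rewrite !ler_norml; lra.
have h2 : \int[cond_on mu [set i]%SET z]_y (`|K|) =
    \int[cond_on mu [set i]%SET x]_y (local_spec mu z (y i) / local_spec mu x (y i) * `|K|).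
  by apply: key => //; bd.
have K0 : `|K| = K.
  by have [h _] := hK x; rewrite ger0_norm// (le_trans _ h).
rewrite K0 in h2.
move: h1; rewrite ExpD//; last by bd.
rewrite h2 -(Exp_eq _ (fun y => esym (mulrDr _ (g y) K))) ExpD; [|by bd|by bd].
by move/addIr.
Qed.

End Conditioning.

(** * The pair inequality *)

Section Covariance.
Variables (R : realType) (N : nat) (Om : 'I_N -> pointedType).
Implicit Types (m : probability (config Om) R) (f : config Om -> R).

(** Since [f] minus its mean integrates to zero, [ln F] may be subtracted from [ln f]; the integrand
    then dominates [2 (f - F)^2 / (f + F)], and a Cauchy-Schwarz argument against [f + F], of mean
    [2 F], concludes. *)
Lemma mean_dev_sqr_le m f (eps M : R) : 0 < eps -> (forall x, eps <= f x <= M) ->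
  (\int[m]_x `|f x - \int[m]_y f y|) ^+ 2 <=
  \int[m]_x f x * \int[m]_x ((f x - \int[m]_y f y) * ln (f x)).
Proof.
move=> e0 fM; set F := \int[m]_x f x; set S := \int[m]_x _; set d := \int[m]_x _.
have fb := bdd_itv fM; have lb := bdd_ln e0 fM.
have f0 x : 0 < f x by apply: lt_le_trans e0 _; case/andP: (fM x).
have F0 : 0 < F by apply: lt_le_trans e0 _; case/andP: (Exp_itv m fM).
have dE : d = \int[m]_x ((f x - F) * (ln (f x) - ln F)).
  rewrite (@Exp_eq _ _ _ m _ (fun x => (f x - F) * ln (f x) - (f x - F) * ln F)); last first.
    by move=> x; rewrite mulrBr.
  rewrite ExpB; [|by bd|by bd].
  rewrite (ExpZr m (ln F)); last by bd.
  by rewrite ExpB ?Exp_cst//; [rewrite subrr mul0r subr0|bd].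
(* The maximizer of [4 lam S - 4 lam^2 F]; completing the square with a free [lam] replaces the
   Cauchy-Schwarz inequality. *)
pose lam := S / (2 * F).
have : \int[m]_x (4 * lam * `|f x - F| - 2 * lam ^+ 2 * (f x + F)) <= d.
  rewrite dE; apply: Exp_le; [by bd|by bd|] => x.
  apply: le_trans (mul_sub_ln_ge (f0 x) F0).
  have s0 : 0 < f x + F by rewrite addr_gt0.
  rewrite ler_pdivlMr// -[(f x - F) ^+ 2]real_normK ?num_real//.
  have := sqr_ge0 (`|f x - F| - lam * (f x + F)); nra.
rewrite ExpB; [|by bd|by bd]; rewrite ExpZl; last by bd.
rewrite ExpZl; last by bd.
rewrite ExpD; [|by bd|by bd]; rewrite Exp_cst -/S -/F => h.
have : F * (4 * lam * S - 2 * lam ^+ 2 * (F + F)) <= F * d by rewrite ler_pM2l.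
by congr (_ <= _); rewrite /lam; field; rewrite gt_eqF.
Qed.

End Covariance.

Section PairInequality.
Variables (R : realType) (N : nat) (Om : 'I_N -> pointedType).
Hypothesis hOm : forall k : 'I_N, countable [set: Om k].
Variable mu : probability (config Om) R.
Hypothesis hmu : forall x : config Om, (0 < mu [set x])%E.
Implicit Types (f g h : config Om -> R) (x y z : config Om).
Implicit Types psi : config Om -> config Om -> R.

Lemma cond_Exp_le B x f g : bdd f -> bdd g -> (forall y, agree_off B x y -> f y <= g y) ->
  \int[cond_on mu B x]_y f y <= \int[cond_on mu B x]_y g y.
Proof.
move=> fb gb fg.
(* The minimum of [f] and [g] agrees with [f] on the block and lies below [g] everywhere. *)
have mb : bdd (fun y => Num.min (f y) (g y)).
  have [K hK] := fb; have [L hL] := gb; exists (K + L) => y.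
  have K0 : 0 <= K := le_trans (normr_ge0 _) (hK y).
  have L0 : 0 <= L := le_trans (normr_ge0 _) (hL y).
  rewrite minEle; case: ifP => _.
    by apply: le_trans (hK y) _; rewrite lerDl.
  by apply: le_trans (hL y) _; rewrite lerDr.
rewrite (cond_Exp_eq hOm hmu fb mb); last by move=> y /fg fy; rewrite min_l.
by apply: Exp_le => // y; rewrite ge_min lexx orbT.
Qed.

Variables i k : 'I_N.
Hypothesis ik : i != k.

(** The expectation over the exchangeable pair in which [y] arises from [x] by resampling coordinate
    [i]. *)
Definition pair_mean psi := \int[mu]_x \int[cond_on mu [set i]%SET x]_y psi x y.
Local Notation M2 := pair_mean.
Local Notation bdd2 psi := (bdd (fun p => psi p.1 p.2)).

Lemma bdd2_row psi x : bdd2 psi -> bdd (psi x).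
Proof. exact: (bdd_comp (fun y => (x, y))). Qed.

Lemma pair_mean_eq psi psi' : (forall x y, psi x y = psi' x y) -> M2 psi = M2 psi'.
Proof. by move=> h; apply: Exp_eq => x; apply: Exp_eq => y. Qed.

Lemma pair_meanD psi psi' : bdd2 psi -> bdd2 psi' ->
  M2 (fun x y => psi x y + psi' x y) = M2 psi + M2 psi'.
Proof.
move=> b b'; rewrite /M2 -ExpD; [|exact: bdd_Exp|exact: bdd_Exp].
by apply: Exp_eq => x; rewrite ExpD//; exact: bdd2_row.
Qed.

Lemma pair_meanB psi psi' : bdd2 psi -> bdd2 psi' ->
  M2 (fun x y => psi x y - psi' x y) = M2 psi - M2 psi'.
Proof.
move=> b b'; rewrite /M2 -ExpB; [|exact: bdd_Exp|exact: bdd_Exp].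
by apply: Exp_eq => x; rewrite ExpB//; exact: bdd2_row.
Qed.

Lemma pair_meanZ c psi : bdd2 psi -> M2 (fun x y => c * psi x y) = c * M2 psi.
Proof.
move=> b; rewrite /M2 -ExpZl; last exact: bdd_Exp.
by apply: Exp_eq => x; rewrite ExpZl//; exact: bdd2_row.
Qed.

Lemma pair_mean_le psi psi' : bdd2 psi -> bdd2 psi' ->
  (forall x y, psi x y <= psi' x y) -> M2 psi <= M2 psi'.
Proof.
move=> b b' h; apply: Exp_le; [exact: bdd_Exp|exact: bdd_Exp|] => x.
by apply: Exp_le; [exact: bdd2_row|exact: bdd2_row|].
Qed.

Lemma pair_mean_swap psi : bdd2 psi -> M2 psi = M2 (fun x y => psi y x).
Proof. exact: cond_on_reversible. Qed.

Lemma pair_mean_fst h : M2 (fun x _ => h x) = \int[mu]_x h x.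
Proof. by apply: Exp_eq => x; rewrite Exp_cst. Qed.

(** By exchangeability [f y * h x] and [f x * h y] have the same mean. *)
Lemma cov_pair_mean f h : bdd f -> bdd h ->
  \int[mu]_x ((f x - \int[cond_on mu [set i]%SET x]_y f y) * h x) =
  M2 (fun x y => f x * (h x - h y)).
Proof.
move=> fb hb.
have f1 : bdd (fun p : config Om * config Om => f p.1) := bdd_comp fst fb.
have f2 : bdd (fun p : config Om * config Om => f p.2) := bdd_comp snd fb.
have h1 : bdd (fun p : config Om * config Om => h p.1) := bdd_comp fst hb.
have h2 : bdd (fun p : config Om * config Om => h p.2) := bdd_comp snd hb.
have Eb : bdd (fun x => \int[cond_on mu [set i]%SET x]_y f y).
  exact: (@bdd_Exp _ _ _ _ _ (fun _ y => f y)).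
transitivity (\int[mu]_x (f x * h x - h x * \int[cond_on mu [set i]%SET x]_y f y)).
  by apply: Exp_eq => x; rewrite mulrBl (mulrC (h x)).
rewrite ExpB; [|by bd|by bd].
rewrite (pair_mean_eq (psi' := fun x y => f x * h x - f x * h y)); last first.
  by move=> x y; rewrite mulrBr.
rewrite (@pair_meanB (fun x y => f x * h x) (fun x y => f x * h y)); [|by bd|by bd].
rewrite (pair_mean_fst (fun x => f x * h x)); congr (_ - _).
rewrite (@pair_mean_swap (fun x y => f x * h y)); last by bd.
by apply: Exp_eq => x; rewrite -ExpZl//; apply: Exp_eq => y; rewrite mulrC.
Qed.

(** * Entropy production, given a function [u] that replaces [f] against pair functions blind to
    coordinate [k] *)

Section EntropyProduction.
Variables (f F d : config Om -> R) (u : config Om -> config Om -> R) (eps M a : R).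
Hypothesis e0 : 0 < eps.
Hypothesis a1 : 1 <= a.
Hypothesis fM : forall x, eps <= f x <= M.
Hypothesis FM : forall x, eps <= F x <= M.
Hypothesis uM : forall x y, eps <= u x y <= M.
Hypothesis db : bdd d.
Hypothesis inv_F : forall x x', agree_off [set k]%SET x x' -> F x' = F x.
Hypothesis inv_u : forall x x' y y',
  agree_off [set k]%SET x x' -> y i = y' i -> u x y = u x' y'.
Hypothesis pair_mean_u : forall psi, bdd2 psi ->
  (forall x z (b : Om i), agree_off [set k]%SET x z -> psi z (upd z b) = psi x (upd x b)) ->
  M2 (fun x y => f x * psi x y) = M2 (fun x y => u x y * psi x y).
Hypothesis ln_u_le : forall x y, exists th, [/\ 0 <= th <= 1,
  `|ln (u x y) - ln (F x)| <= (a - 1) * th & 2 * u x y * th ^+ 2 <= d x].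

Let f_gt0 x : 0 < f x. Proof. by apply: lt_le_trans e0 _; case/andP: (fM x). Qed.

Let u_gt0 x y : 0 < u x y. Proof. by apply: lt_le_trans e0 _; case/andP: (uM x y). Qed.

(** The left side is [X - Di], with [X] the analogue of [Di] for [ln F]. Replacing [f] by [u] lowers
    [Di] to some [Y <= Di], and [X - Y <= (a - 1) * (Y + Dk)]; adding the two estimates gives the
    claim. *)
Lemma entropy_production_le :
  \int[mu]_x ((\int[cond_on mu [set i]%SET x]_y f y - f x) * (ln (f x) - ln (F x))) <=
  (a - 1) * (\int[mu]_x ((f x - \int[cond_on mu [set i]%SET x]_y f y) * ln (f x)) +
             \int[mu]_x d x).
Proof.
set Di := \int[mu]_x (_ * ln (f x)); set Dk := \int[mu]_x d x.
have fb : bdd f := bdd_itv fM.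
have lb : bdd (fun x => ln (f x)) := bdd_ln e0 fM.
have lFb : bdd (fun x => ln (F x)) := bdd_ln e0 FM.
have Fb : bdd F := bdd_itv FM.
have ub : bdd2 u by apply: bdd_itv => q; exact: uM.
have vb : bdd2 (fun x y => u y x) := bdd_comp (fun q => (q.2, q.1)) ub.
have luM (q : config Om * config Om) : ln eps <= ln (u q.1 q.2) <= ln M by exact: ln_itv.
have lub : bdd2 (fun x y => ln (u x y)) := bdd_itv luM.
have lvb : bdd2 (fun x y => ln (u y x)) := bdd_comp (fun q => (q.2, q.1)) lub.
have iub : bdd2 (fun x y => (u x y)^-1).
  by apply: (bdd_inv (f := fun q => u q.1 q.2) e0) => q; exact: uM.
have ivb : bdd2 (fun x y => (u y x)^-1) := bdd_comp (fun q => (q.2, q.1)) iub.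
have f1 : bdd2 (fun x (_ : config Om) => f x) := bdd_comp fst fb.
have f2 : bdd2 (fun (_ : config Om) y => f y) := bdd_comp snd fb.
have l1 : bdd2 (fun x (_ : config Om) => ln (f x)) := bdd_comp fst lb.
have l2 : bdd2 (fun (_ : config Om) y => ln (f y)) := bdd_comp snd lb.
have lF1 : bdd2 (fun x (_ : config Om) => ln (F x)) := bdd_comp fst lFb.
have lF2 : bdd2 (fun (_ : config Om) y => ln (F y)) := bdd_comp snd lFb.
have d1 : bdd2 (fun x (_ : config Om) => d x) := bdd_comp fst db.
have Eb : bdd (fun x => \int[cond_on mu [set i]%SET x]_y f y).
  exact: (@bdd_Exp _ _ _ _ _ (fun _ y => f y)).
have inv_off x z (b : Om i) : agree_off [set k]%SET x z ->
    agree_off [set k]%SET (upd x b) (upd z b).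
  move=> xz j jk; have [->|ji] := eqVneq j i; first by rewrite !upd_same.
  by rewrite !upd_other// xz.
have inv_uu x z (b : Om i) : agree_off [set k]%SET x z -> u z (upd z b) = u x (upd x b).
  by move=> xz; apply: inv_u; [exact: agree_off_sym|rewrite !upd_same].
have inv_vv x z (b : Om i) : agree_off [set k]%SET x z -> u (upd z b) z = u (upd x b) x.
  move=> xz; apply: inv_u; first exact: agree_off_sym (inv_off _ _ _ xz).
  by rewrite xz// finset.in_set1.
pose Y := M2 (fun x y => u x y * (ln (u x y) - ln (u y x))).
pose X := \int[mu]_x ((f x - \int[cond_on mu [set i]%SET x]_y f y) * ln (F x)).
have YDi : Y <= Di.
  rewrite /Di (cov_pair_mean fb lb).
  (* The added summand has mean zero, by the replacement of [f] by [u] and by exchangeability. With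
     it the inequality holds pointwise, as [ln_ratio_le] at [p = f x] and
     [q = f y * (u x y / u y x)]. *)
  have -> : Y = M2 (fun x y => f x * (ln (u x y) - ln (u y x)) + (f x - f y * (u x y / u y x))).
    rewrite (@pair_meanD (fun x y => f x * (ln (u x y) - ln (u y x)))
       (fun x y => f x - f y * (u x y / u y x))); [|by bd|by bd].
    rewrite (@pair_meanB (fun x y => f x) (fun x y => f y * (u x y / u y x))); [|by bd|by bd].
    rewrite (@pair_mean_u (fun x y => ln (u x y) - ln (u y x))); [|by bd|]; last first.
      by move=> x z b xz; rewrite (inv_uu _ _ _ xz) (inv_vv _ _ _ xz).
    rewrite (@pair_mean_swap (fun x y => f y * (u x y / u y x))); last by bd.
    rewrite (@pair_mean_u (fun x y => u y x / u x y)); [|by bd|]; last first.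
      by move=> x z b xz; rewrite (inv_uu _ _ _ xz) (inv_vv _ _ _ xz).
    rewrite (@pair_mean_eq (fun x y => u x y * (u y x / u x y)) (fun x y => u y x)); last first.
      by move=> x y; rewrite mulrCA divff ?mulr1// gt_eqF.
    rewrite -(@pair_mean_swap u)//.
    have -> : M2 (fun x _ => f x) = M2 u; last by rewrite (subrr (M2 u)) addr0.
    transitivity (M2 (fun x _ => f x * 1)).
      by apply: pair_mean_eq => x y; rewrite mulr1.
    rewrite (@pair_mean_u (fun _ _ => 1)); [|by bd|by []].
    by apply: pair_mean_eq => x y; rewrite mulr1.
  apply: pair_mean_le; [by bd|by bd|] => x y.
  have r0 : 0 < f y * (u x y / u y x) by rewrite mulr_gt0// divr_gt0.
  have lE : ln (f y * (u x y / u y x)) = ln (f y) + (ln (u x y) - ln (u y x)).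
    have pr : 0 < u x y / u y x by exact: divr_gt0.
    by rewrite lnM ?posrE// ln_div ?posrE.
  have := ln_ratio_le (f_gt0 x) r0; rewrite lE; lra.
have XE : X = M2 (fun x y => u x y * (ln (F x) - ln (F y))).
  rewrite /X (cov_pair_mean fb lFb) pair_mean_u; [by []|by bd|].
  by move=> x z b xz; rewrite (inv_F xz) (inv_F (inv_off _ _ b xz)).
pose lu x y := ln (u x y) - ln (F x).
have lul : bdd2 lu by rewrite /lu; bd.
have lvl : bdd2 (fun x y => lu y x) := bdd_comp (fun q => (q.2, q.1)) lul.
(* Exchangeability puts the difference [u y x - u x y] in front of [lu x y], which is at most
   [(a - 1) * th] in absolute value; [mul_abs_le_quad] then splits the product into a part of [Y]
   and a part of [d]. *)
have XY : X - Y <= (a - 1) * (Y + Dk).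
  have -> : X - Y = M2 (fun x y => (u y x - u x y) * lu x y).
    rewrite XE /Y -pair_meanB; [|by bd|by bd].
    rewrite (@pair_mean_eq _ (fun x y => u x y * lu y x - u x y * lu x y)); last first.
      by move=> x y; rewrite /lu; ring.
    rewrite (@pair_meanB (fun x y => u x y * lu y x) (fun x y => u x y * lu x y)); [|by bd|by bd].
    rewrite (@pair_mean_swap (fun x y => u x y * lu y x)); last by bd.
    rewrite -pair_meanB; [|by bd|by bd].
    by apply: pair_mean_eq => x y; ring.
  (* Symmetrizing [Y] produces the factor 1/2, which cancels the 2 in [mul_sub_ln_ge]. *)
  have -> : Y + Dk = M2 (fun x y => 2^-1 * ((u x y - u y x) * (ln (u x y) - ln (u y x))) + d x).
    rewrite (@pair_meanD (fun x y => 2^-1 * ((u x y - u y x) * (ln (u x y) - ln (u y x)))));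
      [|by bd|by bd].
    rewrite pair_meanZ; last by bd.
    rewrite pair_mean_fst; congr (_ + _).
    rewrite (@pair_mean_eq _ (fun x y => u x y * (ln (u x y) - ln (u y x)) +
       u y x * (ln (u y x) - ln (u x y)))); last by move=> x y; ring.
    rewrite pair_meanD; [|by bd|by bd].
    rewrite -(@pair_mean_swap (fun x y => u x y * (ln (u x y) - ln (u y x)))); last by bd.
    by rewrite -/Y; field.
  rewrite -pair_meanZ; last by bd.
  apply: pair_mean_le; [by bd|by bd|] => x y.
  have [th [th01 lth uth]] := ln_u_le x y.
  have q1 := mul_abs_le_quad (u_gt0 x y) (u_gt0 y x) th01.
  have q2 := mul_sub_ln_ge (u_gt0 x y) (u_gt0 y x).
  apply: le_trans (ler_norm _) _; rewrite normrM distrC.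
  apply: (@le_trans _ _ ((a - 1) * (`|u x y - u y x| * th))).
    by rewrite mulrCA; apply: ler_wpM2l.
  apply: ler_wpM2l; first by rewrite subr_ge0.
  apply: le_trans q1 _; apply: lerD => //.
  move: q2; rewrite -mulrA; set A := _ / (_ + _); set B := _ * (ln _ - ln _).
  by lra.
have -> : \int[mu]_x ((\int[cond_on mu [set i]%SET x]_y f y - f x) * (ln (f x) - ln (F x))) =
    X - Di.
  rewrite /X /Di -ExpB; [|by bd|by bd].
  by apply: Exp_eq => x; ring.
have aY : (a - 1) * Y <= (a - 1) * Di by apply: ler_wpM2l => //; rewrite subr_ge0.
by rewrite mulrDr; rewrite mulrDr in XY; lra.
Qed.

End EntropyProduction.

Variable a : R.
Hypothesis a1 : 1 <= a.
Hypothesis a2 : a <= 2.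
Hypothesis ha : forall x z (b : Om i), agree_off [set k]%SET x z ->
  local_spec mu z b <= a * local_spec mu x b.

Let a_gt0 : 0 < a. Proof. exact: lt_le_trans a1. Qed.

Let p (b : Om i) x := local_spec mu x b.

Let p_gt0 b x : 0 < p b x. Proof. exact: local_spec_gt0. Qed.

Let p_bdd b : bdd (p b).
Proof. by apply: (@bdd_itv _ _ _ 0 1) => x; rewrite ltW//= local_spec_le1. Qed.

(** Divided by its value at [g = 1], this is the mean of [g] over coordinate [k] given that
    resampling coordinate [i] yields [b]. *)
Definition weighted_mean b g x := \int[cond_on mu [set k]%SET x]_z (p b z * g z).
Local Notation G := weighted_mean.

Lemma weighted_mean_congr b g x x' : agree_off [set k]%SET x x' -> G b g x' = G b g x.
Proof. by move=> h; rewrite /G (cond_on_congr mu h). Qed.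

(** Average over the [k]-block of [x] first, with variable [z]. A change of measure makes the law of
    [y] independent of [z], [psi] does not see the change, and Fubini lets the average over [z] act
    on [g] alone. *)
Lemma pair_mean_weighted g psi : bdd g -> bdd2 psi ->
  (forall x z (b : Om i), agree_off [set k]%SET x z -> psi z (upd z b) = psi x (upd x b)) ->
  M2 (fun x y => g x * psi x y) = M2 (fun x y => psi x y * (G (y i) g x / p (y i) x)).
Proof.
move=> gb pb inv.
(* Truncation at [a] makes the density bounded for all arguments; inside a block it changes
   nothing. *)
pose rr z x (b : Om i) := Num.min (p b z / p b x) a.
have rrb z x b : 0 <= rr z x b <= a.
  rewrite ge_min lexx orbT andbT le_min (ltW a_gt0) andbT.
  by apply: divr_ge0; exact: ltW.
have rrE z x b : agree_off [set k]%SET x z -> rr z x b = p b z / p b x.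
  by move=> xz; rewrite /rr min_l// ler_pdivrMr// ha.
have psib x : bdd (psi x) := bdd2_row x pb.
have Eb : bdd (fun x => \int[cond_on mu [set i]%SET x]_y psi x y) by exact: bdd_Exp.
transitivity (\int[mu]_x (g x * \int[cond_on mu [set i]%SET x]_y psi x y)).
  by apply: Exp_eq => x; rewrite ExpZl.
rewrite -(Exp_cond_on hOm hmu [set k]%SET); last by bd.
apply: Exp_eq => x.
have rz : bdd (fun q : config Om * config Om => rr q.1 x (q.2 i)).
  by apply: bdd_itv => q; exact: rrb.
have E2b : bdd (fun z => \int[cond_on mu [set i]%SET x]_y (rr z x (y i) * psi x y)).
  apply: (@bdd_Exp _ _ _ _ _ (fun z y => rr z x (y i) * psi x y)).
  by apply: bddM => //; exact: (bdd_comp snd (psib x)).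
transitivity (\int[cond_on mu [set k]%SET x]_z (g z *
   \int[cond_on mu [set i]%SET x]_y (rr z x (y i) * psi x y))).
  apply: (cond_Exp_eq hOm hmu); [by bd|by bd|] => z xz; congr (_ * _).
  rewrite (@cond_on1_change _ _ _ hOm mu hmu i x z (psi z) (psi x) a)//.
  - by apply: Exp_eq => y; rewrite rrE.
  - by move=> b; exact: ha.
  - by move=> b; exact: inv.
transitivity (\int[cond_on mu [set k]%SET x]_z
   \int[cond_on mu [set i]%SET x]_y (psi x y * (rr z x (y i) * g z))).
  apply: Exp_eq => z; rewrite -ExpZl; last by apply: bddM => //; exact: (bdd_comp (pair z) rz).
  by apply: Exp_eq => y; ring.
rewrite (Exp_Fubini hOm _ _ (psi := fun z y => psi x y * (rr z x (y i) * g z))); last first.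
  by apply: bddM; [exact: (bdd_comp snd (psib x))|apply: bddM => //; exact: (bdd_comp fst)].
apply: Exp_eq => y.
have rzy : bdd (fun z => rr z x (y i)) := bdd_comp (fun z => (z, y)) rz.
rewrite ExpZl; last by bd.
have pb' := p_bdd (y i); congr (_ * _); rewrite /G -ExpZr; last by bd.
apply: (cond_Exp_eq hOm hmu); [by bd|by bd|] => z xz.
by rewrite rrE// mulrAC.
Qed.

Lemma weighted_mean_gt0 b x : 0 < G b (fun=> 1) x.
Proof.
apply: (@lt_le_trans _ _ (p b x / a)); first by rewrite divr_gt0.
rewrite -(Exp_cst (cond_on mu [set k]%SET x) (p b x / a)).
have pb := p_bdd b; apply: cond_Exp_le; [by bd|by bd|] => z xz.
by rewrite mulr1 ler_pdivrMr// mulrC ha//; exact: agree_off_sym.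
Qed.

Section PositiveFunction.
Variables (f : config Om -> R) (eps M : R).
Hypothesis e0 : 0 < eps.
Hypothesis fM : forall x, eps <= f x <= M.

Let F x := \int[cond_on mu [set k]%SET x]_y f y.
Let u x y := G (y i) f x / G (y i) (fun=> 1) x.

Let fb : bdd f. Proof. exact: bdd_itv fM. Qed.

Let f_gt0 x : 0 < f x. Proof. by apply: lt_le_trans e0 _; case/andP: (fM x). Qed.

Let FM x : eps <= F x <= M. Proof. exact: Exp_itv. Qed.

Let F_gt0 x : 0 < F x. Proof. by apply: lt_le_trans e0 _; case/andP: (FM x). Qed.

Let uM x y : eps <= u x y <= M.
Proof.
have G0 := weighted_mean_gt0 (y i) x; have pb := p_bdd (y i).
rewrite /u ler_pdivlMr// ler_pdivrMr// /G -!ExpZl; [|by bd|by bd].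
have h z : eps * (p (y i) z * 1) <= p (y i) z * f z <= M * (p (y i) z * 1).
  by rewrite mulr1 (mulrC eps) (mulrC M) !ler_pM2l.
by apply/andP; split; apply: Exp_le; (try by bd) => z; case/andP: (h z).
Qed.

Let u_gt0 x y : 0 < u x y. Proof. by apply: lt_le_trans e0 _; case/andP: (uM x y). Qed.

Let u_inv x x' y y' : agree_off [set k]%SET x x' -> y i = y' i -> u x y = u x' y'.
Proof. by move=> h e; rewrite /u e !(weighted_mean_congr _ _ h). Qed.

(** [u] is a conditional expectation of [f x] given the coordinates of [x] outside [k] and the new
    coordinate [i]. Both sides are computed by [pair_mean_weighted], the right one with [g = 1] and
    test function [u * psi]. *)
Lemma pair_mean_u psi : bdd2 psi ->
  (forall x z (b : Om i), agree_off [set k]%SET x z -> psi z (upd z b) = psi x (upd x b)) ->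
  M2 (fun x y => f x * psi x y) = M2 (fun x y => u x y * psi x y).
Proof.
move=> pb inv; rewrite (pair_mean_weighted fb pb inv).
have ub : bdd2 u by apply: bdd_itv => q; exact: uM.
transitivity (M2 (fun x y => 1 * (u x y * psi x y))); last first.
  by apply: pair_mean_eq => x y; rewrite mul1r.
rewrite [RHS](@pair_mean_weighted (fun=> 1) (fun x y => u x y * psi x y)); [|by bd|by bd|].
  apply: pair_mean_eq => x y; rewrite /u; field.
  by rewrite (gt_eqF (p_gt0 _ _)) (gt_eqF (weighted_mean_gt0 _ _)).
move=> x z b xz; rewrite (inv _ _ _ xz); congr (_ * _); apply: u_inv; first exact: agree_off_sym.
by rewrite !upd_same.
Qed.

Let d x := \int[cond_on mu [set k]%SET x]_z ((f z - F x) * ln (f z)).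

Let lu x y := ln (u x y) - ln (F x).

(* The density of the weighted mean oscillates within [[m, a m]], so subtracting
   its midpoint gains the factor 1/2. *)
Lemma ln_weighted_mean_le x y : exists th, [/\ 0 <= th <= 1,
  `|lu x y| <= (a - 1) * th & 2 * u x y * th ^+ 2 <= d x].
Proof.
pose b := y i.
pose P := [set p b z | z in agree_off [set k]%SET x].
have P0 : lbound P 0 by move=> _ [z _ <-]; exact: ltW.
have PN : P !=set0 by exists (p b x), x.
pose m := inf P.
have mp z : agree_off [set k]%SET x z -> m <= p b z.
  by move=> xz; apply: ge_inf; [exists 0|exists z].
have pm z : agree_off [set k]%SET x z -> p b z <= a * m.
  move=> xz; rewrite mulrC -ler_pdivrMr//; apply: lb_le_inf => // _ [z' xz' <-].
  rewrite ler_pdivrMr// mulrC; apply: ha => j jk.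
  by rewrite xz// xz'.
have m0 : 0 < m.
  by rewrite -(pmulr_rgt0 _ a_gt0); apply: lt_le_trans (pm x _).
have pb := p_bdd b.
pose G1 := G b (fun=> 1) x.
have G10 : 0 < G1 by exact: weighted_mean_gt0.
have mG1 : m <= G1.
  rewrite -(Exp_cst (cond_on mu [set k]%SET x) m); apply: cond_Exp_le; [by bd|by bd|].
  by move=> z xz; rewrite mulr1 mp.
pose S := \int[cond_on mu [set k]%SET x]_z `|f z - F x|.
have S0 : 0 <= S by apply: Exp_ge0.
have SF : S <= 2 * F x.
  have -> : 2 * F x = \int[cond_on mu [set k]%SET x]_z (f z + F x).
    by rewrite ExpD ?Exp_cst//; [rewrite mulr_natl mulr2n|bd].
  apply: Exp_le; [by bd|by bd|] => z.
  by apply: le_trans (ler_normB _ _) _; rewrite !gtr0_norm.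
have Sd : S ^+ 2 <= F x * d x by exact: mean_dev_sqr_le fM.
have Gf : G b f x = u x y * G1 by rewrite /u divfK ?gt_eqF.
(* As [f - F] has mean zero on the block, any constant may be subtracted from the weight. *)
have GfF : G b f x - F x * G1 = \int[cond_on mu [set k]%SET x]_z
    ((p b z - m * (1 + a) / 2) * (f z - F x)).
  transitivity (\int[cond_on mu [set k]%SET x]_z
    (p b z * f z - F x * (p b z * 1) - m * (1 + a) / 2 * (f z - F x))).
    rewrite ExpB; [|by bd|by bd]; rewrite ExpB; [|by bd|by bd].
    rewrite ExpZl; last by bd.
    rewrite ExpZl; last by bd.
    by rewrite ExpB ?Exp_cst//; [rewrite subrr mulr0 subr0|bd].
  by apply: Exp_eq => z; ring.
have dev : `|u x y - F x| * G1 <= m * ((a - 1) / 2 * S).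
  rewrite -[X in _ * X](gtr0_norm G10) -normrM mulrBl -Gf GfF.
  apply: le_trans (le_normr_Rintegral _ _) _ => //.
    apply: (@bdd_integrable _ _ _ _ (fun z => (p b z - m * (1 + a) / 2) * (f z - F x))).
    by bd.
  rewrite mulrA -ExpZl; last by bd.
  apply: cond_Exp_le; [by bd|by bd|] => z xz; rewrite normrM ler_wpM2r//.
  by rewrite ler_norml; have := mp z xz; have := pm z xz; nra.
(* This lower bound allows the deviation [dev] to be measured relative to [u] as well as relative to
   [F]. *)
have uF : m * F x <= u x y * G1.
  rewrite -Gf -ExpZl//; apply: cond_Exp_le; [by bd|by bd|] => z xz.
  by rewrite ler_pM2r ?mp.
(* Uses [a <= 2] and [m <= G1]. It turns [2 * u * th ^+ 2] into at most [S ^+ 2 / F], which [Sd]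
   bounds by [d]. *)
have uF2 : u x y <= 2 * F x.
  rewrite -(ler_pM2r G10) -Gf; apply: (@le_trans _ _ (a * m * F x)).
    rewrite -ExpZl//; apply: cond_Exp_le; [by bd|by bd|] => z xz.
    by rewrite ler_pM2r ?pm.
  rewrite [leRHS]mulrAC ler_pM2r//.
  by apply: ler_pM => //; exact: ltW.
(* The mean deviation relative to its largest possible value [2 F], hence in the unit interval. *)
exists (S / (2 * F x)); have F0 := F_gt0 x; have u0 := u_gt0 x y.
have F20 : 0 < 2 * F x by rewrite mulr_gt0.
split.
- by rewrite divr_ge0 ?(ltW F20)//= ler_pdivrMr// mul1r.
- apply: abs_ln_sub_le => //.
  + rewrite -(ler_pM2r G10); apply: le_trans dev _.
    have -> : (a - 1) * (S / (2 * F x)) * u x y * G1 =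
       ((a - 1) / 2 * S) / F x * (u x y * G1) by field; rewrite gt_eqF.
    apply: (@le_trans _ _ ((a - 1) / 2 * S / F x * (m * F x))).
      by rewrite le_eqVlt; apply/orP; left; apply/eqP; field; rewrite gt_eqF.
    apply: ler_wpM2l => //; apply: divr_ge0; last exact: ltW.
    by apply: mulr_ge0 => //; apply: divr_ge0 => //; rewrite subr_ge0.
  + rewrite -(ler_pM2r G10); apply: le_trans dev _.
    have -> : (a - 1) * (S / (2 * F x)) * F x * G1 = G1 * ((a - 1) / 2 * S).
      by field; rewrite gt_eqF.
    apply: ler_wpM2r => //.
    by apply: mulr_ge0 => //; apply: divr_ge0 => //; rewrite subr_ge0.
- rewrite -(ler_pM2l F0); apply: le_trans Sd.
  have -> : F x * (2 * u x y * (S / (2 * F x)) ^+ 2) = u x y / (2 * F x) * S ^+ 2.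
    by field; rewrite gt_eqF.
  by apply: ler_piMl; [exact: sqr_ge0|rewrite ler_pdivrMr// mul1r].
Qed.

Lemma pair_entropy_production_le :
  \int[mu]_x ((\int[cond_on mu [set i]%SET x]_y f y - f x) *
    (ln (f x) - ln (\int[cond_on mu [set k]%SET x]_y f y))) <=
  (a - 1) * (\int[mu]_x ((f x - \int[cond_on mu [set i]%SET x]_y f y) * ln (f x)) +
             \int[mu]_x ((f x - \int[cond_on mu [set k]%SET x]_y f y) * ln (f x))).
Proof.
have lb : bdd (fun x => ln (f x)) := bdd_ln e0 fM.
have Fb : bdd F := bdd_itv FM.
have inv_F x x' : agree_off [set k]%SET x x' -> F x' = F x.
  by move=> xx'; rewrite /F (cond_on_congr mu xx').
have db : bdd d.
  apply: (@bdd_Exp _ _ _ _ _ (fun x z => (f z - F x) * ln (f z))).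
  apply: bddM; last exact: (bdd_comp snd lb).
  by apply: bddD; [exact: (bdd_comp snd fb)|apply: bddN; exact: (bdd_comp fst Fb)].
(* Averaging over the [k]-block first, where [F] is constant, identifies the mean of the local
   production [d]. *)
have dE : \int[mu]_x d x = \int[mu]_x ((f x - F x) * ln (f x)).
  rewrite -[RHS](Exp_cond_on hOm hmu [set k]%SET); last by bd.
  apply: Exp_eq => x; rewrite /d; apply: (cond_Exp_eq hOm hmu); [by bd|by bd|] => z xz.
  by rewrite (inv_F _ _ xz).
rewrite -dE.
exact: (entropy_production_le e0 a1 fM FM uM db inv_F u_inv pair_mean_u ln_weighted_mean_le).
Qed.

End PositiveFunction.
End PairInequality.

(** * Euler steps of the heat bath dynamics *)

Section EntropyTangent.
Variable R : realType.
Implicit Types a b M eps : R.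

Lemma xlnx_tangent_le a b : 0 < a -> 0 < b ->
  a * ln a + (1 + ln a) * (b - a) <= b * ln b.
Proof. by move=> a0 b0; have := ln_ratio_le b0 a0; lra. Qed.

(** From [ln b <= ln a + (b - a) / a]. The quadratic remainder is the source of the second-order
    error of an Euler step. *)
Lemma xlnx_tangent_ge a b : 0 < a -> 0 < b ->
  b * ln b <= a * ln a + (1 + ln a) * (b - a) + (b - a) ^+ 2 / a.
Proof.
move=> a0 b0; have h := ln_ratio_le a0 b0.
have : b * ln b <= b * (ln a + (b - a) / a).
  by rewrite ler_pM2l// -lerBlDl ler_pdivlMr// mulrC.
move=> /le_trans; apply; rewrite le_eqVlt; apply/orP; left; apply/eqP.
by field; rewrite gt_eqF.
Qed.

Lemma xlnx_sub_le a b eps M : 0 < eps -> eps <= a <= M -> eps <= b <= M ->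
  a * ln a - b * ln b <= (1 + `|ln eps| + `|ln M|) * `|a - b|.
Proof.
move=> e0 aM bM; have /andP[a1 a2] := aM; have /andP[b1 b2] := bM.
have h := xlnx_tangent_le (lt_le_trans e0 a1) (lt_le_trans e0 b1).
apply: (@le_trans _ _ ((1 + ln a) * (a - b))); first by lra.
apply: le_trans (ler_norm _) _; rewrite normrM ler_wpM2r//.
have /andP[l1 l2] := ln_itv e0 aM.
rewrite ler_norml; have := ler_norm (ln M); have := ler_norm (- ln eps); rewrite normrN.
have := normr_ge0 (ln eps); have := normr_ge0 (ln M); lra.
Qed.

Lemma ler_add_inv_nat (a b C : R) n0 : 0 <= C ->
  (forall n, (n0 < n)%N -> a <= b + C / n%:R) -> a <= b.
Proof.
move=> C0 h; rewrite leNgt; apply/negP => ba.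
have ab0 : 0 < a - b by rewrite subr_gt0.
pose n := (n0 + Num.truncn (C / (a - b))).+1.
have := h n; rewrite ltnS leq_addr => /(_ isT).
have nC : C / (a - b) < n%:R.
  apply: lt_le_trans (truncnS_gt _) _; last by rewrite ler_nat ltnS leq_addl.
have n00 : (0 : R) < n%:R by rewrite ltr0n.
rewrite ltr_pdivrMr// in nC.
by rewrite -lerBlDl ler_pdivlMr// leNgt mulrC nC.
Qed.

End EntropyTangent.

(** * Positivity and uniform continuity of the entropy *)

Section EntropyFunctional.
Variables (R : realType) (N : nat) (Om : 'I_N -> pointedType).
Implicit Types (m : probability (config Om) R) (f g : config Om -> R).

Lemma bdd_xlnx (T : Type) (f : T -> R) eps M : 0 < eps -> (forall x, eps <= f x <= M) ->
  bdd (fun x => f x * ln (f x)).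
Proof. by move=> e0 fM; apply: bddM; [exact: bdd_itv fM|exact: bdd_ln e0 fM]. Qed.

(** Jensen's inequality, obtained by integrating the tangent of [t ln t] at the mean of [f]. *)
Lemma Ent_ge0 m f eps M : 0 < eps -> (forall x, eps <= f x <= M) -> 0 <= Ent m f.
Proof.
move=> e0 fM; rewrite /Ent; set c := \int[m]_x f x.
have fb := bdd_itv fM; have b1 := bdd_xlnx e0 fM.
have /andP[c1 c2] : eps <= c <= M by exact: Exp_itv.
have c0 := lt_le_trans e0 c1.
have h : \int[m]_x (c * ln c + (1 + ln c) * (f x - c)) <= \int[m]_x (f x * ln (f x)).
  apply: Exp_le; [by bd|by bd|] => x; apply: xlnx_tangent_le => //.
  by apply: lt_le_trans e0 _; case/andP: (fM x).
move: h; rewrite ExpD; [|by bd|by bd]; rewrite Exp_cst ExpZl; last by bd.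
by rewrite ExpB ?Exp_cst; [rewrite -/c subrr mulr0 addr0 subr_ge0|by bd|by bd].
Qed.

Lemma Ent_sub_le m f g eps M eta : 0 < eps ->
  (forall x, eps <= f x <= M) -> (forall x, eps <= g x <= M) ->
  (forall x, `|f x - g x| <= eta) ->
  Ent m f <= Ent m g + 2 * (1 + `|ln eps| + `|ln M|) * eta.
Proof.
move=> e0 fM gM fg; set L := 1 + _ + _.
have L0 : 0 <= L by rewrite /L !addr_ge0.
have fb := bdd_itv fM; have b1 := bdd_xlnx e0 fM.
have gb := bdd_itv gM; have b2 := bdd_xlnx e0 gM.
have h1 : \int[m]_x (f x * ln (f x)) - \int[m]_x (g x * ln (g x)) <= L * eta.
  rewrite -ExpB//; rewrite -[leRHS](Exp_cst m); apply: Exp_le; [by bd|by bd|] => x.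
  by apply: le_trans (xlnx_sub_le e0 (fM x) (gM x)) _; apply: ler_wpM2l.
have h2 := xlnx_sub_le e0 (Exp_itv m gM) (Exp_itv m fM).
have h3 : `|\int[m]_x g x - \int[m]_x f x| <= eta.
  by rewrite -ExpB//; apply: Exp_norm_le => x; rewrite distrC.
have h4 := ler_wpM2l L0 h3.
by rewrite /Ent; rewrite -/L in h2; lra.
Qed.

End EntropyFunctional.

(* Locked, since unification would otherwise unfold the integrals. *)
HB.lock Definition cexp (R : realType) (N : nat) (Om : 'I_N -> pointedType)
    (mu : probability (config Om) R) (B : {set 'I_N}) (f : config Om -> R)
    (x : config Om) : R :=
  \int[cond_on mu B x]_y f y.

(** * Conditional entropies and their change under one Euler step *)

Section HeatBathEuler.
Variables (R : realType) (N : nat) (Om : 'I_N -> pointedType).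
Hypothesis hOm : forall k : 'I_N, countable [set: Om k].
Variable mu : probability (config Om) R.
Hypothesis hmu : forall x : config Om, (0 < mu [set x])%E.
Implicit Types (f g h : config Om -> R).

Local Notation L := (heat_bath_gen mu).

Lemma cexpE B f : cexp mu B f = (fun x => \int[cond_on mu B x]_y f y).
Proof. by rewrite cexp.unlock. Qed.

Lemma Exp_cexp B f : bdd f -> \int[mu]_x cexp mu B f x = \int[mu]_x f x.
Proof. by rewrite cexp.unlock; exact: Exp_cond_on. Qed.

Lemma bdd_cexp B f : bdd f -> bdd (cexp mu B f).
Proof.
move=> fb; rewrite cexp.unlock; apply: (@bdd_Exp _ _ _ _ _ (fun _ y => f y)).
exact: (bdd_comp snd).
Qed.

Lemma cexp_itv B f a b : (forall x, a <= f x <= b) -> forall x, a <= cexp mu B f x <= b.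
Proof. by move=> h x; rewrite cexp.unlock; exact: Exp_itv. Qed.


Lemma cexp_congr B f x y : agree_off B x y -> cexp mu B f y = cexp mu B f x.
Proof. by move=> xy; rewrite cexp.unlock (cond_on_congr mu xy). Qed.

Lemma mean_Ent_cond_on B f eps M : 0 < eps -> (forall x, eps <= f x <= M) ->
  \int[mu]_x Ent (cond_on mu B x) f =
  \int[mu]_x (f x * ln (f x)) - \int[mu]_x (cexp mu B f x * ln (cexp mu B f x)).
Proof.
move=> e0 fM; have b1 := bdd_xlnx e0 fM.
have b2 := bdd_xlnx e0 (cexp_itv B fM).
rewrite -(Exp_cond_on hOm hmu B b1) -ExpB.
- by apply: Exp_eq => x; rewrite cexp.unlock.
- by rewrite -(cexpE B); exact: bdd_cexp.
- by [].
Qed.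

(* Tangents at the conditional expectations integrate to zero. *)
Lemma cexp_sub_tower B f h : bdd f -> bdd h ->
  (forall x y, agree_off B x y -> h y = h x) ->
  \int[mu]_x (h x * (f x - cexp mu B f x)) = 0.
Proof.
move=> fb hb hB; have cb := bdd_cexp B fb.
rewrite (@Exp_eq _ _ _ mu _ (fun x => h x * f x - h x * cexp mu B f x)); last first.
  by move=> x; rewrite mulrBr.
rewrite ExpB; [|by bd|by bd].
by apply/eqP; rewrite subr_eq0 cexp.unlock (cond_on_tower hOm hmu fb hb hB).
Qed.

(** The tangent at [cexp mu B f] is evaluated at [cexp mu A f]. Its linear term is split as
    [(f - cexp mu B f) - (f - cexp mu A f)], and both pieces integrate to zero because a function
    constant on [B]-blocks is constant on [A]-blocks. *)
Lemma mean_Ent_mono (A B : {set 'I_N}) f eps M : 0 < eps -> (forall x, eps <= f x <= M) ->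
  A \subset B ->
  \int[mu]_x Ent (cond_on mu A x) f <= \int[mu]_x Ent (cond_on mu B x) f.
Proof.
move=> e0 fM AB; rewrite (mean_Ent_cond_on A e0 fM) (mean_Ent_cond_on B e0 fM) lerD2l lerN2.
have fb := bdd_itv fM.
have cA := cexp_itv A fM; have cB := cexp_itv B fM.
have bA := bdd_itv cA; have bB := bdd_itv cB.
have xA := bdd_xlnx e0 cA; have xB := bdd_xlnx e0 cB; have lB := bdd_ln e0 cB.
have lA := bdd_ln e0 cA.
have inv x y : agree_off B x y -> 1 + ln (cexp mu B f y) = 1 + ln (cexp mu B f x).
  by move=> xy; rewrite (cexp_congr f xy).
have invA x y : agree_off A x y -> 1 + ln (cexp mu B f y) = 1 + ln (cexp mu B f x).
  by move=> xy; apply: inv; exact: agree_off_sub AB xy.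
have hb : bdd (fun x => 1 + ln (cexp mu B f x)) by bd.
have h1 := cexp_sub_tower fb hb inv; have h2 := cexp_sub_tower fb hb invA.
have h3 : \int[mu]_x (cexp mu B f x * ln (cexp mu B f x) +
    ((1 + ln (cexp mu B f x)) * (f x - cexp mu B f x) - (1 + ln (cexp mu B f x)) * (f x - cexp mu A f x)))
    <= \int[mu]_x (cexp mu A f x * ln (cexp mu A f x)).
  apply: Exp_le; [by bd|by bd|] => x.
  have /andP[a1 _] := cA x; have /andP[c1 _] := cB x.
  have := xlnx_tangent_le (lt_le_trans e0 c1) (lt_le_trans e0 a1); lra.
move: h3; rewrite ExpD; [|by bd|by bd].
by rewrite ExpB; [rewrite h1 h2 subrr addr0|by bd|by bd].
Qed.

Definition dirichlet k f := \int[mu]_x ((f x - cexp mu [set k]%SET f x) * ln (f x)).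

(** Subtracting the logarithm of the conditional mean from [ln f] does not change the integral, and
    makes the integrand nonnegative. *)
Lemma dirichlet_ge0 k f eps M : 0 < eps -> (forall x, eps <= f x <= M) -> 0 <= dirichlet k f.
Proof.
move=> e0 fM; have fb := bdd_itv fM; have lb := bdd_ln e0 fM.
have cM := cexp_itv [set k]%SET fM; have cb := bdd_itv cM; have clb := bdd_ln e0 cM.
have h : \int[mu]_x (ln (cexp mu [set k]%SET f x) * (f x - cexp mu [set k]%SET f x)) = 0.
  by apply: cexp_sub_tower => // x y xy; rewrite (cexp_congr f xy).
have -> : dirichlet k f = \int[mu]_x ((f x - cexp mu [set k]%SET f x) *
    (ln (f x) - ln (cexp mu [set k]%SET f x))).
  rewrite -[LHS]subr0 -h /dirichlet -ExpB; [|by bd|by bd].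
  by apply: Exp_eq => x; ring.
apply: Exp_ge0 => x.
by apply: mul_sub_ln_ge0; apply: lt_le_trans e0 _; [case/andP: (fM x)|case/andP: (cM x)].
Qed.

Definition euler_step s f x := f x + s * L f x.

Lemma heat_bath_genE f x : L f x = \sum_(k < N) (cexp mu [set k]%SET f x - f x).
Proof. by rewrite cexp.unlock. Qed.

Lemma bdd_gen f : bdd f -> bdd (L f).
Proof.
move=> fb; have h k : bdd (fun x => cexp mu [set k]%SET f x - f x).
  by have cb := bdd_cexp [set k]%SET fb; bd.
by have [K hK] := bdd_sum (index_enum 'I_N) predT h; exists K => x; rewrite heat_bath_genE.
Qed.

(** For [s * N <= 1] the step is a convex combination of [f] and its [N] single-site conditional
    means. *)
Lemma euler_step_itv s f a b : 0 <= s -> s * N%:R <= 1 ->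
  (forall x, a <= f x <= b) -> forall x, a <= euler_step s f x <= b.
Proof.
move=> s0 sN fM x; have /andP[f1 f2] := fM x.
have h (c : R) : (forall k, cexp mu [set k]%SET f x <= c) -> L f x <= N%:R * (c - f x).
  move=> hc; rewrite heat_bath_genE -[N in N%:R]card_ord mulr_natl -sumr_const.
  by apply: ler_sum => k _; rewrite lerD2r.
have h' (c : R) : (forall k, c <= cexp mu [set k]%SET f x) -> N%:R * (c - f x) <= L f x.
  move=> hc; rewrite heat_bath_genE -[N in N%:R]card_ord mulr_natl -sumr_const.
  by apply: ler_sum => k _; rewrite lerD2r.
have h1 : L f x <= N%:R * (b - f x) by apply: h => k; case/andP: (cexp_itv [set k]%SET fM x).
have h2 : N%:R * (a - f x) <= L f x by apply: h' => k; case/andP: (cexp_itv [set k]%SET fM x).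
have h3 := ler_wpM2l s0 h1; have h4 := ler_wpM2l s0 h2.
rewrite /euler_step; apply/andP; split; nra.
Qed.

Variable gam : R.
Hypothesis gam1 : gam < 1.
Hypothesis decay : forall f eps M, 0 < eps -> (forall x, eps <= f x <= M) ->
  \sum_(k < N) \sum_(i < N) \int[mu]_x ((cexp mu [set i]%SET f x - f x) *
     (ln (f x) - ln (cexp mu [set k]%SET f x))) <= - (1 - gam) * \sum_(k < N) dirichlet k f.

Definition tensor_gap f :=
  \sum_(k < N) \int[mu]_x Ent (cond_on mu [set k]%SET x) f - (1 - gam) * Ent mu f.

(** The global entropy is bounded below by a tangent, without error. The conditional ones are
    bounded above with error [(s L f)^2 / f], where [L f] is at most [N M] in absolute value and
    [f >= eps]; this occurs once per site. By [decay] the first-order terms add up to at most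
    zero. *)
Lemma tensor_gap_euler f eps M s : 0 < eps -> (forall x, eps <= f x <= M) ->
  0 <= s -> s * N%:R <= 1 ->
  tensor_gap (euler_step s f) <= tensor_gap f + s ^+ 2 * (N%:R * (N%:R * M) ^+ 2 / eps).
Proof.
have aux (A A' D V E E' : R) : A' <= A + s * (- (1 - gam) * D) + V ->
    (1 - gam) * (E - s * D) <= (1 - gam) * E' ->
    A' - (1 - gam) * E' <= A - (1 - gam) * E + V by lra.
move=> e0 fM s0 sN; set g := euler_step s f.
have gM : forall x, eps <= g x <= M by exact: euler_step_itv.
have f0 x : 0 < f x by apply: lt_le_trans e0 _; case/andP: (fM x).
have g0 x : 0 < g x by apply: lt_le_trans e0 _; case/andP: (gM x).
have fb := bdd_itv fM; have gb := bdd_itv gM.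
have flb := bdd_ln e0 fM; have glb := bdd_ln e0 gM.
have fxb := bdd_xlnx e0 fM; have gxb := bdd_xlnx e0 gM.
have Lb := bdd_gen fb.
have genI h : bdd h ->
    \int[mu]_x (L f x * h x) = \sum_(i < N) \int[mu]_x ((cexp mu [set i]%SET f x - f x) * h x).
  move=> hb; rewrite -Exp_sum; last first.
    by move=> i; have cb := bdd_cexp [set i]%SET fb; bd.
  by apply: Exp_eq => x; rewrite heat_bath_genE mulr_suml.
have gf x : g x - f x = s * L f x by rewrite /g /euler_step addrC addKr.
have mean_L : \int[mu]_x L f x = 0.
  rewrite (@Exp_eq _ _ _ mu _ (fun x => \sum_(i < N) (cexp mu [set i]%SET f x - f x))); last first.
    by move=> x; rewrite heat_bath_genE.
  rewrite Exp_sum; last by move=> i; have cb := bdd_cexp [set i]%SET fb; bd.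
  rewrite big1// => i _.
  by rewrite ExpB//; [rewrite Exp_cexp// subrr|exact: bdd_cexp].
have mean_g : \int[mu]_x g x = \int[mu]_x f x.
  by rewrite /g /euler_step ExpD; [rewrite ExpZl// mean_L mulr0 addr0|by bd|by bd].
have ent_g : Ent mu f - s * \sum_(k < N) dirichlet k f <= Ent mu g.
  rewrite /Ent mean_g -addrAC lerD2r.
  have : \int[mu]_x (f x * ln (f x) + (g x - f x) + s * (L f x * ln (f x))) <=
      \int[mu]_x (g x * ln (g x)).
    apply: Exp_le; [by bd|by bd|] => x.
    by have := xlnx_tangent_le (f0 x) (g0 x); rewrite mulrA -gf; lra.
  rewrite ExpD; [|by bd|by bd]; rewrite ExpD; [|by bd|by bd].
  rewrite ExpB// mean_g subrr addr0 ExpZl; last by bd.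
  rewrite genI//; congr (_ + _ <= _); rewrite -mulrN -sumrN; congr (_ * _).
  apply: eq_bigr => k _; have cb := bdd_cexp [set k]%SET fb.
  rewrite /dirichlet -ExpN; last by bd.
  by apply: Exp_eq => x; rewrite -mulNr opprB.
have Lnorm x : `|L f x| <= N%:R * M.
  rewrite heat_bath_genE; apply: le_trans (ler_norm_sum _ _ _) _.
  rewrite -[N in N%:R]card_ord mulr_natl -sumr_const; apply: ler_sum => k _.
  have /andP[a1 a2] := fM x; have /andP[c1 c2] := cexp_itv [set k]%SET fM x.
  by rewrite ler_norml; lra.
pose Kc := (N%:R * M) ^+ 2 / eps.
have ent_k k : \int[mu]_x Ent (cond_on mu [set k]%SET x) g <=
    \int[mu]_x Ent (cond_on mu [set k]%SET x) f +
    s * (\sum_(i < N) \int[mu]_x ((cexp mu [set i]%SET f x - f x) *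
     (ln (f x) - ln (cexp mu [set k]%SET f x)))) + s ^+ 2 * Kc.
  set B := [set k]%SET.
  have cfM := cexp_itv B fM; have cgM := cexp_itv B gM.
  have cfb := bdd_itv cfM; have cgb := bdd_itv cgM.
  have cflb := bdd_ln e0 cfM; have cfxb := bdd_xlnx e0 cfM; have cgxb := bdd_xlnx e0 cgM.
  have cglb := bdd_ln e0 cgM.
  rewrite (mean_Ent_cond_on B e0 fM) (mean_Ent_cond_on B e0 gM).
  have inv x y : agree_off B x y -> 1 + ln (cexp mu B f y) = 1 + ln (cexp mu B f x).
    by move=> xy; rewrite (cexp_congr f xy).
  have hb : bdd (fun x => 1 + ln (cexp mu B f x)) by bd.
  have z1 := cexp_sub_tower fb hb inv; have z2 := cexp_sub_tower gb hb inv.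
  rewrite -genI; last by bd.
  (* The subtracted linear terms have mean zero by [z1] and [z2]; including them makes the
     comparison pointwise. *)
  have : \int[mu]_x ((g x * ln (g x) - cexp mu B g x * ln (cexp mu B g x)) -
        (1 + ln (cexp mu B f x)) * (g x - cexp mu B g x)) <=
      \int[mu]_x ((f x * ln (f x) - cexp mu B f x * ln (cexp mu B f x)) -
        (1 + ln (cexp mu B f x)) * (f x - cexp mu B f x) +
        s * (L f x * (ln (f x) - ln (cexp mu B f x))) + s ^+ 2 * Kc).
    apply: Exp_le; [by bd|by bd|] => x.
    have c0 : 0 < cexp mu B f x by apply: lt_le_trans e0 _; case/andP: (cfM x).
    have d0 : 0 < cexp mu B g x by apply: lt_le_trans e0 _; case/andP: (cgM x).
    have t1 := xlnx_tangent_ge (f0 x) (g0 x).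
    have t2 := xlnx_tangent_le c0 d0.
    have t3 : (g x - f x) ^+ 2 / f x <= s ^+ 2 * Kc.
      rewrite gf exprMn -mulrA; apply: ler_wpM2l; first exact: sqr_ge0.
      apply: ler_pM; rewrite ?sqr_ge0 ?invr_ge0 ?(ltW (f0 x))//.
        by rewrite -[leLHS]real_normK ?num_real// lerXn2r// nnegrE// (le_trans _ (Lnorm x)).
      by rewrite lef_pV2 ?posrE//; case/andP: (fM x).
    have : s * (L f x * (ln (f x) - ln (cexp mu B f x))) =
      (g x - f x) * (ln (f x) - ln (cexp mu B f x)) by rewrite gf mulrA.
    by move=> ->; lra.
  rewrite [leLHS]ExpB; [|by bd|by bd]; rewrite z2 subr0.
  rewrite [leLHS]ExpB; [|by bd|by bd].
  move=> /le_trans; apply; rewrite le_eqVlt; apply/orP; left; apply/eqP.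
  rewrite ExpD; [|by bd|by bd]; rewrite ExpD; [|by bd|by bd].
  rewrite ExpB; [|by bd|by bd]; rewrite z1 subr0 Exp_cst.
  rewrite ExpB; [|by bd|by bd].
  by rewrite ExpZl; last by bd.
have sum_k : \sum_(k < N) \int[mu]_x Ent (cond_on mu [set k]%SET x) g <=
    \sum_(k < N) \int[mu]_x Ent (cond_on mu [set k]%SET x) f +
    s * (- (1 - gam) * \sum_(k < N) dirichlet k f) + N%:R * (s ^+ 2 * Kc).
  apply: le_trans (ler_sum _ (fun k _ => ent_k k)) _.
  rewrite !big_split/= -mulr_sumr sumr_const card_ord mulr_natl lerD2r lerD2l.
  by apply: ler_wpM2l => //; exact: decay e0 fM.
have g1 : 0 <= 1 - gam by rewrite subr_ge0 ltW.
have -> : s ^+ 2 * (N%:R * (N%:R * M) ^+ 2 / eps) = N%:R * (s ^+ 2 * Kc).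
  by rewrite /Kc; ring.
exact: aux sum_k (ler_wpM2l g1 ent_g).
Qed.

Lemma tensor_gap_iter f eps M s n : 0 < eps -> (forall x, eps <= f x <= M) ->
  0 <= s -> s * N%:R <= 1 ->
  (forall x, eps <= iter n (euler_step s) f x <= M) /\
  tensor_gap (iter n (euler_step s) f) <=
    tensor_gap f + n%:R * (s ^+ 2 * (N%:R * (N%:R * M) ^+ 2 / eps)).
Proof.
move=> e0 fM s0 sN; elim: n => [|n [h1 h2]] /=.
  by split=> //; rewrite mul0r addr0.
split; first exact: euler_step_itv.
apply: le_trans (tensor_gap_euler e0 h1 s0 sN) _.
by rewrite -[n.+1]addn1 natrD mulrDl mul1r addrA lerD2r.
Qed.

End HeatBathEuler.

(** * Convergence of the Euler scheme *)

Section ExponentialSeries.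
Variable R : realType.
Implicit Types y : R.

Lemma partial_exp_le y p : 0 <= y -> \sum_(j < p) y ^+ j / j`!%:R <= expR y.
Proof.
move=> y0; rewrite -(big_mkord xpredT (fun j => y ^+ j / j`!%:R)).
apply: (@nondecreasing_cvgn_le R (series (exp_coeff y))).
- apply: nondecreasing_series => j _ _; exact: exp_coeff_ge0.
- exact: is_cvg_series_exp_coeff.
Qed.

(** With [z = y / n], the bound [exp (z - z^2) <= 1 + z] is raised to the power [n], and then
    [exp (- y^2 / n) >= 1 - y^2 / n]. The first bound rests on
    [(1 - z + z^2) (1 + z) = 1 + z^3 >= 1]. *)
Lemma expR_sub_power_le y n : (0 < n)%N -> 0 <= y ->
  expR y - (1 + y / n%:R) ^+ n <= expR y * y ^+ 2 / n%:R.
Proof.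
move=> n0 y0; have n0' : (0 : R) < n%:R by rewrite ltr0n.
pose z := y / n%:R; have z0 : 0 <= z by rewrite divr_ge0// ltW.
have z1 : 0 < 1 + z by lra.
have h1 : expR (z - z ^+ 2) <= 1 + z.
  have := expR_ge1Dx (- (z - z ^+ 2)); rewrite expRN => h.
  rewrite -lef_pV2 ?posrE ?expR_gt0//; apply: le_trans h.
  rewrite -[_^-1]mul1r ler_pdivrMr//.
  have : 0 <= z ^+ 3 by exact: exprn_ge0.
  have -> : (1 - (z - z ^+ 2)) * (1 + z) = 1 + z ^+ 3 by ring.
  by lra.
have h2 : expR (y - y ^+ 2 / n%:R) <= (1 + z) ^+ n.
  have -> : y - y ^+ 2 / n%:R = (z - z ^+ 2) * n%:R.
    by rewrite /z; field; rewrite gt_eqF.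
  by rewrite expRM_natr lerXn2r// nnegrE ?expR_ge0// ltW.
have h3 : expR y * (1 - y ^+ 2 / n%:R) <= expR (y - y ^+ 2 / n%:R).
  by rewrite expRD ler_pM2l ?expR_gt0// expR_ge1Dx.
rewrite -/z; move: h2 h3; rewrite mulrBr mulr1 mulrA; lra.
Qed.

End ExponentialSeries.

Lemma ffact_le_expn n m : (n ^_ m <= n ^ m)%N.
Proof. by elim: m => // m IH; rewrite ffactnSr expnSr leq_mul ?leq_subr. Qed.

Section EulerLimit.
Variables (R : realType) (N : nat) (Om : 'I_N -> pointedType).
Variable mu : probability (config Om) R.
Implicit Types (f g : config Om -> R).
Local Notation L := (heat_bath_gen mu).

Lemma gen_norm_le f K : (forall x, `|f x| <= K) -> forall x, `|L f x| <= (2 * N%:R) * K.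
Proof.
move=> fK x; rewrite heat_bath_genE; apply: le_trans (ler_norm_sum _ _ _) _.
have -> : 2 * N%:R * K = \sum_(k < N) (2 * K) by rewrite sumr_const card_ord -mulr_natl; ring.
apply: ler_sum => k _; apply: le_trans (ler_normB _ _) _.
have h : forall y, - K <= f y <= K by move=> y; rewrite -ler_norml.
have := cexp_itv mu [set k]%SET h x; rewrite -ler_norml => h1.
by have := fK x; lra.
Qed.

Lemma iter_gen_norm_le f K n : (forall x, `|f x| <= K) ->
  forall x, `|iter n L f x| <= (2 * N%:R) ^+ n * K.
Proof.
move=> fK; elim: n => [|n IH] x /=; first by rewrite expr0 mul1r.
by rewrite exprS -mulrA; exact: gen_norm_le.
Qed.

Lemma bdd_iter_gen f n : bdd f -> bdd (iter n L f).
Proof. by move=> [K hK]; exists ((2 * N%:R) ^+ n * K); exact: iter_gen_norm_le. Qed.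

Lemma gen_sum n (c : 'I_n -> R) (h : 'I_n -> config Om -> R) x : (forall j, bdd (h j)) ->
  L (fun y => \sum_(j < n) c j * h j y) x = \sum_(j < n) c j * L (h j) x.
Proof.
move=> hb; rewrite /heat_bath_gen.
under [RHS]eq_bigr do rewrite mulr_sumr.
rewrite exchange_big /=; apply: eq_bigr => k _.
rewrite Exp_sum; last by move=> j; have := hb j => hj; bd.
rewrite -sumrB; apply: eq_bigr => j _.
by rewrite ExpZl// mulrBr.
Qed.

(** The binomial expansion of [(1 + s L)^n]. Any cutoff [p > n] is allowed, as higher binomials
    vanish, so that it can be compared with long partial sums of the exponential series. *)
Lemma iter_euler_stepE s f n p x : bdd f -> (n < p)%N ->
  iter n (euler_step mu s) f x =
  \sum_(j < p) 'C(n, j)%:R * s ^+ j * iter j L f x.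
Proof.
move=> fb; elim: n p x => [|n IH] [//|p] x np.
  rewrite big_ord_recl big1 ?addr0 /= ?bin0 ?mul1r// => j _.
  by rewrite !mul0r.
rewrite iterS /euler_step.
have E : iter n (euler_step mu s) f =
    fun y => \sum_(j < p) ('C(n, j)%:R * s ^+ j) * iter j L f y.
  by apply/funext => y; rewrite (IH p).
rewrite [X in L X x]E gen_sum; last by move=> j; exact: bdd_iter_gen.
rewrite (IH p.+1 x (leqW np)) [LHS]/= [in LHS]big_ord_recl [RHS]big_ord_recl /=.
rewrite !bin0 -addrA; congr (_ + _).
rewrite mulr_sumr -big_split /=; apply: eq_bigr => j _.
by rewrite /bump /= !add1n binS natrD exprS; ring.
Qed.

(** The coefficients of the exponential series dominate those of the Euler polynomial. With
    [iter_gen_norm_le] the error is therefore at most [M] times the scalar difference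
    [exp y - (1 + y / n)^n], where [y = 2 N t]. *)
Lemma iter_euler_step_cvg f M s n x : (forall x, `|f x| <= M) -> 0 <= s -> (0 < n)%N ->
  `|heat_bath_semigroup mu (s * n%:R) f x - iter n (euler_step mu s) f x| <=
  M * (expR (s * n%:R * (2 * N%:R)) * (s * n%:R * (2 * N%:R)) ^+ 2 / n%:R).
Proof.
move=> fM s0 n0; have fb : bdd f by exists M.
have n0' : (0 : R) < n%:R by rewrite ltr0n.
set t := s * n%:R; set y := t * (2 * N%:R).
have t0 : 0 <= t by rewrite mulr_ge0.
have y0 : 0 <= y by rewrite !mulr_ge0.
have M0 : 0 <= M := le_trans (normr_ge0 _) (fM x).
pose u (j : nat) := t ^+ j / j`!%:R * iter j L f x.
set g := iter n _ f x; set eta := M * _.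
have coefM j : `|iter j L f x| <= (2 * N%:R) ^+ j * M by exact: iter_gen_norm_le.
have le_u j : `|u j| <= M * (y ^+ j / j`!%:R).
  rewrite normrM ger0_norm ?divr_ge0 ?exprn_ge0//.
  have -> : M * (y ^+ j / j`!%:R) = t ^+ j / j`!%:R * ((2 * N%:R) ^+ j * M).
    by rewrite /y exprMn; ring.
  by apply: ler_wpM2l => //; rewrite divr_ge0 ?exprn_ge0.
have cvg_u : cvgn (series u).
  apply: normed_cvg; apply: (series_le_cvg _ _ le_u).
  - by move=> j.
  - by move=> j; rewrite mulr_ge0// divr_ge0 ?exprn_ge0.
  - have := @is_cvg_seriesZ R (exp_coeff y) M (is_cvg_series_exp_coeff y).
    by [].
have sub p : (n < p)%N -> `|series u p - g| <= eta.
  move=> np; rewrite /series /= big_mkord /g (iter_euler_stepE s x fb np) -sumrB.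
  (* After multiplication by [j!] this says that the falling factorial of [n] is at most [n ^ j]. *)
  have cf (j : 'I_p) : 0 <= t ^+ j / j`!%:R - 'C(n, j)%:R * s ^+ j.
    rewrite subr_ge0 /t exprMn -mulrA mulrC; apply: ler_wpM2l; first exact: exprn_ge0.
    rewrite ler_pdivlMr ?ltr0n ?fact_gt0// -natrM -natrX ler_nat.
    by rewrite bin_ffact; exact: ffact_le_expn.
  apply: le_trans (ler_norm_sum _ _ _) _.
  apply: (@le_trans _ _ (\sum_(j < p) (t ^+ j / j`!%:R - 'C(n, j)%:R * s ^+ j) * ((2 * N%:R) ^+ j * M))).
    by apply: ler_sum => j _; rewrite -mulrBl normrM (ger0_norm (cf j)) ler_wpM2l.
  have -> : \sum_(j < p) (t ^+ j / j`!%:R - 'C(n, j)%:R * s ^+ j) * ((2 * N%:R) ^+ j * M) =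
      M * (\sum_(j < p) y ^+ j / j`!%:R - (1 + y / n%:R) ^+ n).
    have -> : (1 + y / n%:R) ^+ n = \sum_(j < p) 'C(n, j)%:R * (s * (2 * N%:R)) ^+ j.
      have -> : y / n%:R = s * (2 * N%:R) by rewrite /y /t; field; rewrite gt_eqF.
      rewrite exprDn -(subnKC np) big_split_ord /= [X in _ = _ + X]big1 ?addr0.
        apply: eq_bigr => j _.
        by rewrite expr1n mul1r [RHS]mulr_natl.
      by move=> j _; rewrite bin_small ?mul0r// addSn ltnS leq_addr.
    rewrite -sumrB mulr_sumr; apply: eq_bigr => j _.
    by rewrite /y !exprMn; ring.
  apply: ler_wpM2l => //; apply: le_trans (expR_sub_power_le n0 y0).
  by rewrite lerD2r; exact: partial_exp_le.
have lo : g - eta <= limn (series u).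
  apply: limr_ge => //; exists n.+1 => // p /= np.
  by have := sub p np; rewrite ler_norml; lra.
have up : limn (series u) <= g + eta.
  apply: limr_le => //; exists n.+1 => // p /= np.
  by have := sub p np; rewrite ler_norml; lra.
rewrite ler_norml /heat_bath_semigroup -/u; lra.
Qed.

End EulerLimit.

(** * Approximate tensorization *)

Section Tensorization.
Variables (R : realType) (N : nat) (Om : 'I_N -> pointedType).
Hypothesis hOm : forall k : 'I_N, countable [set: Om k].
Variable mu : probability (config Om) R.
Hypothesis hmu : forall x : config Om, (0 < mu [set x])%E.
Implicit Types (f g : config Om -> R).
Variable gam : R.
Hypothesis gam1 : gam < 1.
Hypothesis decay : forall f eps M, 0 < eps -> (forall x, eps <= f x <= M) ->
  \sum_(k < N) \sum_(i < N) \int[mu]_x ((cexp mu [set i]%SET f x - f x) *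
     (ln (f x) - ln (cexp mu [set k]%SET f x))) <= - (1 - gam) * \sum_(k < N) dirichlet mu k f.

(** Run [n] Euler steps of size [t / n]: the gap grows by at most [t^2 K / n]. At the end the
    conditional entropies are dropped, being nonnegative, and the global entropy is compared with
    that of the semigroup; then [n] is arbitrary. *)
Lemma tensor_gap_semigroup f eps M t : 0 < eps -> (forall x, eps <= f x <= M) -> 0 <= t ->
  0 <= tensor_gap mu gam f + (1 - gam) * Ent mu (heat_bath_semigroup mu t f).
Proof.
move=> e0 fM t0.
have M0 : 0 <= M.
  by have /andP[h1 h2] := fM point; rewrite (le_trans (ltW e0))// (le_trans h1).
have fN x : `|f x| <= M.
  have /andP[h1 h2] := fM x; rewrite ger0_norm//; exact: le_trans (ltW e0) h1.
set y := t * (2 * N%:R); pose A := M * (expR y * y ^+ 2).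
have A0 : 0 <= A by rewrite /A !mulr_ge0 ?expR_ge0 ?sqr_ge0.
pose K := N%:R * (N%:R * M) ^+ 2 / eps.
have K0 : 0 <= K by rewrite /K divr_ge0 ?mulr_ge0 ?sqr_ge0 ?(ltW e0).
pose Lc := 1 + `|ln eps| + `|ln M|.
have Lc0 : 0 <= Lc by rewrite /Lc !addr_ge0.
have g1 : 0 <= 1 - gam by rewrite subr_ge0 ltW.
(* For [n > n0] the step size satisfies [(t / n) * N <= 1]. *)
pose n0 := Num.truncn (t * N%:R).
pose g n := iter n (euler_step mu (t / n%:R)) f.
have step n : (n0 < n)%N -> [/\ (forall x, eps <= g n x <= M),
    tensor_gap mu gam (g n) <= tensor_gap mu gam f + t ^+ 2 * K / n%:R &
    forall x, `|g n x - heat_bath_semigroup mu t f x| <= A / n%:R].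
  move=> n0n; have n00 : (0 < n)%N by apply: leq_ltn_trans n0n.
  have n1 : (0 : R) < n%:R by rewrite ltr0n.
  have s0 : 0 <= t / n%:R by rewrite divr_ge0// ltW.
  have sN : t / n%:R * N%:R <= 1.
    rewrite mulrAC ler_pdivrMr// mul1r; apply: le_trans (ltW (truncnS_gt _)) _.
    by rewrite ler_nat.
  have [h1 h2] := tensor_gap_iter hOm hmu gam1 decay n e0 fM s0 sN.
  split=> //.
    apply: le_trans h2 _; rewrite lerD2l le_eqVlt; apply/orP; left; apply/eqP.
    by rewrite /K; field; rewrite !gt_eqF.
  move=> x; have := iter_euler_step_cvg mu x fN s0 n00.
  by rewrite divfK ?gt_eqF// -/y distrC /A !mulrA.
have ftM x : eps <= heat_bath_semigroup mu t f x <= M.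
  apply/andP; split; apply: (@ler_add_inv_nat _ _ _ A n0) => // n /step[h1 _ h3].
  - by have := h1 x; have := h3 x; rewrite ler_norml; lra.
  - by have := h1 x; have := h3 x; rewrite ler_norml; lra.
apply: (@ler_add_inv_nat _ _ _ (t ^+ 2 * K + (1 - gam) * (2 * Lc * A)) n0).
  by apply: addr_ge0; apply: mulr_ge0; rewrite ?sqr_ge0// !mulr_ge0.
move=> n /step[h1 h2 h3].
have h4 := Ent_sub_le mu e0 h1 ftM h3; rewrite -/Lc in h4.
have h5 := ler_wpM2l g1 h4.
have h6 : 0 <= \sum_(k < N) \int[mu]_x Ent (cond_on mu [set k]%SET x) (g n).
  by apply: sumr_ge0 => k _; apply: Exp_ge0 => x; exact: Ent_ge0 e0 h1.
have -> : (t ^+ 2 * K + (1 - gam) * (2 * Lc * A)) / n%:R =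
  t ^+ 2 * K / n%:R + (1 - gam) * (2 * Lc * (A / n%:R)) by ring.
have aux (S E F G T V W : R) : 0 <= S -> S - (1 - gam) * E <= G + V ->
   (1 - gam) * E <= (1 - gam) * (F + W) ->
   0 <= G + (1 - gam) * F + (V + (1 - gam) * W) by lra.
exact: aux h6 h2 h5.
Qed.

Hypothesis hlim : forall f : config Om -> R, bounded_fun f -> (forall x, 0 <= f x) ->
  Ent mu (heat_bath_semigroup mu t f) @[t --> +oo] --> (0 : R).

(** Letting [t] tend to infinity in [tensor_gap_semigroup] removes the entropy term and leaves the
    initial gap nonnegative. *)
Lemma approximate_tensorization f eps M : 0 < eps -> (forall x, eps <= f x <= M) ->
  (1 - gam) * Ent mu f <= \sum_(k < N) \int[mu]_x Ent (cond_on mu [set k]%SET x) f.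
Proof.
move=> e0 fM; rewrite -subr_ge0 -/(tensor_gap mu gam f).
have f0 x : 0 <= f x by case/andP: (fM x) => h _; exact: le_trans (ltW e0) h.
have g0 : 0 < 1 - gam by rewrite subr_gt0.
have := hlim (bounded_fun_bdd (bdd_itv fM)) f0.
move=> h.
have near0 : \forall t \near +oo,
    - tensor_gap mu gam f / (1 - gam) <= Ent mu (heat_bath_semigroup mu t f).
  near=> t; rewrite ler_pdivrMr// mulrC -subr_ge0 opprK addrC.
  by apply: tensor_gap_semigroup e0 fM _; near: t; exact: nbhs_pinfty_ge.
have := cvgr_to_ge h near0; rewrite ler_pdivrMr// mul0r oppr_le0; exact.
Unshelve. all: by end_near.
Qed.

End Tensorization.

(** * From the interaction coefficients to the dissipation inequality *)

Section Coefficients.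
Variables (R : realType) (N : nat) (Om : 'I_N -> pointedType).
Hypothesis hOm : forall k : 'I_N, countable [set: Om k].
Variable mu : probability (config Om) R.
Hypothesis hmu : forall x : config Om, (0 < mu [set x])%E.
Hypothesis hN : (0 < N)%N.
Local Open Scope ereal_scope.

Lemma phi_le_alpha i k xi yi xk (z : config Om) :
  (phi mu (i := i) (k := k) xi yi xk z)%:E <= alpha mu i k.
Proof. by apply: ereal_sup_ubound; exists xi, yi, xk, z. Qed.

Lemma alpha_ge1 i k : 1 <= alpha mu i k.
Proof.
apply: le_trans (@phi_le_alpha i k point point point point).
by rewrite /phi divff// gt_eqF// local_spec_gt0.
Qed.

Lemma delta_ge0 i k : 0 <= delta mu i k.
Proof.
apply: ereal_sup_ubound; exists point, point, point, point, point.
by rewrite subrr normr0.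
Qed.

Lemma le_bigmaxe (F : 'I_N -> \bar R) i : F i <= \big[maxe/-oo]_(j < N) F j.
Proof. by rewrite (bigD1 i)//= le_max lexx. Qed.

(** The maximum starts from [-oo], so an actual index is needed to bound it below. *)
Lemma gamma_ge0 : 0 <= gamma mu.
Proof. by apply: le_trans (le_bigmaxe _ (Ordinal hN)); apply: sume_ge0. Qed.

Lemma kappa_ge0 : 0 <= kappa mu.
Proof.
apply: mule_ge0; first by rewrite lee_fin invr_ge0 ler0n.
apply: le_trans (le_bigmaxe _ (Ordinal hN)); apply: sume_ge0 => k _.
rewrite mule_ge0 ?adde_ge0 ?delta_ge0// mule_ge0//.
  by apply: le_trans (alpha_ge1 _ _); rewrite lee_fin.
by apply: le_trans (alpha_ge1 _ _); rewrite lee_fin.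
Qed.

Hypothesis hgk : gamma mu + kappa mu < 1.

Lemma gamma_fin : gamma mu \is a fin_num.
Proof.
rewrite ge0_fin_numE ?gamma_ge0//; apply: le_lt_trans (lt_trans hgk (ltry 1)).
by rewrite leeDl// kappa_ge0.
Qed.

Lemma kappa_fin : kappa mu \is a fin_num.
Proof.
rewrite ge0_fin_numE ?kappa_ge0//; apply: le_lt_trans (lt_trans hgk (ltry 1)).
by rewrite leeDr// gamma_ge0.
Qed.

Lemma fine_gamma_kappa : (fine (gamma mu) + fine (kappa mu) < 1)%R.
Proof. by rewrite -lte_fin EFinD !fineK ?gamma_fin ?kappa_fin. Qed.

(** An infinite [alpha mu i k] times [alpha mu k i >= 1] would make [gamma mu] infinite. *)
Lemma alpha_fin i k : i != k -> alpha mu i k \is a fin_num.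
Proof.
move=> ik; rewrite ge0_fin_numE; last by apply: le_trans (alpha_ge1 _ _); rewrite lee_fin.
have h : `|alpha mu i k * alpha mu k i - 1| <= gamma mu.
  apply: le_trans (le_bigmaxe _ i); rewrite (bigD1 k) 1?eq_sym//=.
  by rewrite leeDl// sume_ge0.
rewrite ltNge leye_eq; apply/negP => /eqP ioo; move: h; rewrite ioo.
rewrite gt0_mulye; last by apply: lt_le_trans (alpha_ge1 _ _); rewrite lte_fin.
rewrite /= leye_eq => /eqP goo.
by have := gamma_fin; rewrite goo.
Qed.

Local Close Scope ereal_scope.

Let a i k := fine (alpha mu i k).

Let a_ge1 i k : i != k -> 1 <= a i k.
Proof. by move=> ik; rewrite -lee_fin fineK ?alpha_fin ?alpha_ge1. Qed.

Lemma sum_alpha_le i : \sum_(k < N | k != i) (a i k * a k i - 1) <= fine (gamma mu).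
Proof.
rewrite -lee_fin fineK ?gamma_fin// -sumEFin.
apply: le_trans (le_bigmaxe _ i); apply: lee_sum => k ki.
rewrite EFinB EFinM /a !fineK ?alpha_fin// 1?eq_sym//.
exact: lee_abs.
Qed.

(** The order of indices matters: coordinate [k] varies and the law of coordinate [i] responds, so
    the factor is [a k i]. *)
Lemma local_spec_le_alpha i k : i != k ->
  forall x z (b : Om i), agree_off [set k]%SET x z ->
  local_spec mu z b <= a k i * local_spec mu x b.
Proof.
move=> ik x z b xz; rewrite -ler_pdivrMr ?local_spec_gt0//.
have := @phi_le_alpha k i (z k) (x k) b x.
rewrite /phi -(agree_off1E xz) -(agree_off1E (@agree_off_refl _ _ [set k]%SET x)).
by move=> h; rewrite -lee_fin fineK//; apply: alpha_fin; rewrite eq_sym.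
Qed.

Lemma heat_bath_decay (f : config Om -> R) eps M : 0 < eps -> (forall x, eps <= f x <= M) ->
  \sum_(k < N) \sum_(i < N) \int[mu]_x ((cexp mu [set i]%SET f x - f x) *
     (ln (f x) - ln (cexp mu [set k]%SET f x))) <=
  - (1 - fine (gamma mu)) * \sum_(k < N) dirichlet mu k f.
Proof.
move=> e0 fM; pose D k := dirichlet mu k f.
have D0 k : 0 <= D k by exact: dirichlet_ge0 e0 fM.
pose T i k := \int[mu]_x ((cexp mu [set i]%SET f x - f x) *
     (ln (f x) - ln (cexp mu [set k]%SET f x))).
have Tkk k : T k k = - D k.
  have fb := bdd_itv fM; have lb := bdd_ln e0 fM.
  have cM := cexp_itv mu [set k]%SET fM; have cb := bdd_itv cM; have clb := bdd_ln e0 cM.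
  have h : \int[mu]_x (ln (cexp mu [set k]%SET f x) * (f x - cexp mu [set k]%SET f x)) = 0.
    by apply: cexp_sub_tower => // x y xy; rewrite (cexp_congr mu f xy).
  rewrite -[LHS]subr0 -h /T /D /dirichlet -ExpB; [|by bd|by bd].
  rewrite -ExpN; last by bd.
  by apply: Exp_eq => x; ring.
have Tik i k : i != k -> T i k <= (a k i - 1) * (D i + D k).
  move=> ik; have ki : k != i by rewrite eq_sym.
  (* Since [a i k >= 1], one has [a k i <= a i k * a k i <= 1 + gamma], and [gamma < 1]. *)
  have a2 : a k i <= 2.
    have h1 := a_ge1 ik; have h2 := a_ge1 ki.
    have h3 : a i k * a k i - 1 <= fine (gamma mu).
      apply: le_trans (sum_alpha_le i); rewrite (bigD1 k)//= lerDl.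
      apply: sumr_ge0 => j /andP[ji _]; rewrite subr_ge0.
      by apply: mulr_ege1; rewrite a_ge1// eq_sym.
    have h4 := fine_gamma_kappa; have h5 : 0 <= fine (kappa mu) by rewrite fine_ge0// kappa_ge0.
    nra.
  have := pair_entropy_production_le hOm hmu ik (a_ge1 ki) a2 (local_spec_le_alpha ik) e0 fM.
  by rewrite /T /D /dirichlet !cexpE.
pose B i k := (if i == k then - D k else (a k i - 1) * (D i + D k)).
have TB i k : T i k <= B i k.
  by rewrite /B; case: eqVneq => [->|ik]; [rewrite Tkk|exact: Tik].
have -> : - (1 - fine (gamma mu)) * \sum_(k < N) D k =
    - \sum_(k < N) D k + \sum_(k < N) D k * fine (gamma mu) by rewrite -mulr_suml; ring.
apply: (@le_trans _ _ (\sum_(k < N) \sum_(i < N) B i k)).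
  by apply: ler_sum => k _; apply: ler_sum => i _; exact: TB.
have -> : \sum_(k < N) \sum_(i < N) B i k =
    - \sum_(k < N) D k + \sum_(k < N) \sum_(i < N | i != k) (a k i - 1) * (D i + D k).
  rewrite -sumrN -big_split/=; apply: eq_bigr => k _.
  rewrite (bigD1 k)//= {1}/B eqxx; congr (_ + _); apply: eq_bigr => i ik.
  by rewrite /B (negbTE ik).
rewrite lerD2l.
(* Exchanging the two indices in the [D i] part collects the full coefficient of each [D k]. *)
have -> : \sum_(k < N) \sum_(i < N | i != k) (a k i - 1) * (D i + D k) =
    \sum_(k < N) \sum_(i < N | i != k) D k * ((a k i - 1) + (a i k - 1)).
  transitivity (\sum_(k < N) \sum_(i < N | i != k) (a k i - 1) * D k +
                \sum_(k < N) \sum_(i < N | i != k) (a k i - 1) * D i).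
    rewrite -big_split/=; apply: eq_bigr => k _; rewrite -big_split/=.
    by apply: eq_bigr => i _; ring.
  rewrite [X in _ + X](exchange_big_dep xpredT)//= -big_split/=; apply: eq_bigr => k _.
  under [X in _ + X]eq_bigl do rewrite eq_sym.
  by rewrite -big_split/=; apply: eq_bigr => i _; ring.
apply: ler_sum => k _; rewrite -mulr_sumr; apply: ler_wpM2l => //.
apply: le_trans (sum_alpha_le k); apply: ler_sum => i ik.
(* What remains is [0 <= (a i k - 1) * (a k i - 1)]. *)
have h1 := a_ge1 ik; have h2 : 1 <= a k i by apply: a_ge1; rewrite eq_sym.
nra.
Qed.

End Coefficients.

(** * Nonnegative functions and covers *)

Section SquareShift.
Variable R : realType.
Implicit Types s t M : R.

Lemma xlnx_itv t M : 0 <= t <= M -> -1 <= t * ln t <= M ^+ 2.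
Proof.
move=> /andP[t0 tM]; have [->|tn0] := eqVneq t 0.
  by rewrite mul0r sqr_ge0 andbT; lra.
have tp : 0 < t by rewrite lt_neqAle eq_sym tn0.
have h1 := ln_ratio_le tp ltr01; have h2 := ln_ratio_le ltr01 tp.
rewrite ln1 in h1 h2; apply/andP; split; first by lra.
have h3 : ln t <= t by lra.
apply: le_trans (ler_wpM2l t0 h3) _.
by rewrite expr2; apply: ler_pM.
Qed.

(** The shift is a square because [s^2 ln (s^2) = 2 s (s ln s) >= - 2 s]: the logarithmic
    singularity at zero then costs an error linear in [s]. *)
Lemma xlnx_shift_le t s M : 0 <= t <= M -> 0 < s <= 1 ->
  `|(t + s ^+ 2) * ln (t + s ^+ 2) - t * ln t| <= (2 + M) * s.
Proof.
move=> /andP[t0 tM] /andP[s0 s1].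
have d0 : 0 < s ^+ 2 by exact: exprn_gt0.
have ds : s ^+ 2 <= s by rewrite expr2 ger_pMl.
set d := s ^+ 2 in d0 ds *; set w := t + d.
have w0 : 0 < w by rewrite /w; lra.
have lnw : ln w <= w - 1 by have := ln_ratio_le ltr01 w0; rewrite ln1; lra.
have up : w * ln w - t * ln t <= d * (1 + ln w).
  have [e|tn0] := eqVneq t 0.
    have -> : w = d by rewrite /w e add0r.
    by rewrite e mul0r subr0 mulrDr mulr1 lerDr ltW.
  have tp : 0 < t by rewrite lt_neqAle eq_sym tn0.
  by have := xlnx_tangent_le w0 tp; rewrite /w; lra.
have lo : d * ln d <= w * ln w - t * ln t.
  have h1 : ln d <= ln w by rewrite ler_ln ?posrE// /w lerDr.
  have h2 : t * ln t <= t * ln w.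
    have [->|tn0] := eqVneq t 0; first by rewrite !mul0r.
    have tp : 0 < t by rewrite lt_neqAle eq_sym tn0.
    by rewrite ler_pM2l// ler_ln ?posrE// /w lerDl ltW.
  have h3 : d * ln d <= d * ln w by rewrite ler_pM2l.
  have -> : w * ln w = t * ln w + d * ln w by rewrite /w; ring.
  by lra.
have dln : - (2 * s) <= d * ln d.
  have h := ln_ratio_le s0 ltr01; rewrite ln1 sub0r in h.
  have -> : d * ln d = 2 * s * (s * ln s) by rewrite /d lnXn// -mulr_natl; ring.
  have : s * -1 <= s * (s * ln s) by rewrite ler_pM2l//; lra.
  by lra.
have dw : d * (1 + ln w) <= s * (1 + M).
  apply: (@le_trans _ _ (d * (1 + M))); last by apply: ler_wpM2r => //; lra.
  by rewrite ler_pM2l//; rewrite /w in lnw *; lra.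
have sM : 0 <= s * M by rewrite mulr_ge0 ?(ltW s0)// (le_trans t0).
by rewrite ler_norml; apply/andP; split; lra.
Qed.

End SquareShift.

Section ShiftedEntropy.
Variables (R : realType) (N : nat) (Om : 'I_N -> pointedType).
Implicit Types (m : probability (config Om) R) (f : config Om -> R).

Lemma bdd_xlnx0 (T : Type) (f : T -> R) M :
  (forall x, 0 <= f x <= M) -> bdd (fun x => f x * ln (f x)).
Proof. by move=> fM; apply: bdd_itv => x; exact: xlnx_itv. Qed.

Lemma Ent_shift m f s M : (forall x, 0 <= f x <= M) -> 0 < s <= 1 ->
  `|Ent m (fun x => f x + s ^+ 2) - Ent m f| <= 2 * (2 + M) * s.
Proof.
move=> fM s01; have fb := bdd_itv fM.
have /andP[s0 s1] := s01.
have d1 : s ^+ 2 <= 1 by rewrite expr_le1// ltW.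
have gM x : 0 <= f x + s ^+ 2 <= M + 1.
  by have := fM x; have := sqr_ge0 s; lra.
have b1 := bdd_xlnx0 fM; have b2 := bdd_xlnx0 gM.
rewrite /Ent [X in _ - X * ln X - _]ExpD; [|by bd|by bd]; rewrite Exp_cst.
have h1 : `|\int[m]_x ((f x + s ^+ 2) * ln (f x + s ^+ 2)) - \int[m]_x (f x * ln (f x))|
    <= (2 + M) * s.
  by rewrite -ExpB//; apply: Exp_norm_le => x; exact: xlnx_shift_le.
have h2 := xlnx_shift_le (Exp_itv m fM) s01.
move: h1 h2; rewrite !ler_norml; lra.
Qed.

Lemma bdd_Ent (S : Type) (kap : S -> probability (config Om) R) f M :
  (forall x, 0 <= f x <= M) -> bdd (fun s => Ent (kap s) f).
Proof.
move=> fM; have b1 := bdd_xlnx0 fM.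
apply: bddD.
  by apply: (@bdd_Exp _ _ _ _ _ (fun _ y => f y * ln (f y))); exact: (bdd_comp snd b1).
by apply: bddN; apply: bdd_xlnx0 => s; exact: Exp_itv.
Qed.

End ShiftedEntropy.

(** * Double counting over a cover *)

Section Covers.
Variables (R : realType) (N : nat).
Implicit Types (Bs : seq {set 'I_N}) (B : {set 'I_N}).

Lemma cover_deg_gt0 Bs k : is_cover Bs -> (0 < cover_deg Bs k)%N.
Proof.
rewrite /is_cover => cov; have : k \in [set: 'I_N]%SET by rewrite finset.in_setT.
rewrite -cov -has_count; elim: Bs {cov} => [|B Bs IH]; first by rewrite big_nil finset.in_set0.
by rewrite big_cons finset.in_setU /= => /orP[->//|/IH ->]; rewrite orbT.
Qed.

Lemma min_deg_gt0 Bs : (0 < N)%N -> is_cover Bs -> (0 < min_deg Bs)%N.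
Proof.
move=> N0 cov; rewrite /min_deg; elim/big_ind: _ => [|x y hx hy|k _].
(* The initial value [size Bs] of the minimum is positive because it bounds a degree. *)
- by apply: leq_trans (cover_deg_gt0 (Ordinal N0) cov) (count_size _ _).
- by rewrite leq_min hx.
- exact: cover_deg_gt0.
Qed.

Lemma min_deg_le Bs k : (min_deg Bs <= cover_deg Bs k)%N.
Proof.
rewrite /min_deg; have := mem_index_enum k.
elim: (index_enum _) => // i r IH; rewrite inE big_cons geq_min.
by case/orP => [/eqP<-|/IH ->]; rewrite ?leqnn// orbT.
Qed.

(** Summing [e k] over all incidences of a site with a block gives the degrees when grouped by site,
    and at most [#|B| * E B] when grouped by block. *)
Lemma sum_cover_le Bs (e : 'I_N -> R) (E : {set 'I_N} -> R) :
  (forall k, 0 <= e k) -> (forall B, 0 <= E B) ->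
  (forall B k, k \in B -> e k <= E B) ->
  (min_deg Bs)%:R * \sum_(k < N) e k <= (max_block Bs)%:R * \sum_(B <- Bs) E B.
Proof.
move=> e0 E0 eE.
apply: (@le_trans _ _ (\sum_(k < N) (cover_deg Bs k)%:R * e k)).
  by rewrite mulr_sumr; apply: ler_sum => k _; rewrite ler_wpM2r// ler_nat min_deg_le.
apply: (@le_trans _ _ (\sum_(B <- Bs) #|B|%:R * E B)).
  have -> : \sum_(k < N) (cover_deg Bs k)%:R * e k = \sum_(B <- Bs) \sum_(k in B) e k.
    under [RHS]eq_bigr do rewrite big_mkcond/=.
    rewrite exchange_big/=; apply: eq_bigr => k _.
    rewrite -big_mkcond/= /cover_deg; elim: Bs => [|B Bs IH].
      by rewrite big_nil mul0r.
    by rewrite big_cons /= natrD mulrDl IH; case: (k \in B); rewrite ?mul1r// mul0r add0r.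
  apply: ler_sum => B _; rewrite mulr_natl -sumr_const.
  by apply: ler_sum => k; exact: eE.
rewrite mulr_sumr big_seq [leRHS]big_seq; apply: ler_sum => B BBs.
by rewrite ler_wpM2r// ler_nat /max_block leq_bigmax_seq.
Qed.

End Covers.

(** * Blocks from single sites, and passage from positive to nonnegative functions *)

Theorem corollary2p7 (R : realType) (N : nat) (hN : (0 < N)%N)
    (Om : 'I_N -> pointedType) (hOm : forall k : 'I_N, countable [set: Om k])
    (mu : probability (config Om) R)
    (hmu : forall x : config Om, (0 < mu [set x])%E)
    (hlim : forall f : config Om -> R, bounded_fun f -> (forall x, 0 <= f x) ->
       Ent mu (heat_bath_semigroup mu t f) @[t --> +oo] --> (0 : R))
    (hgk : (gamma mu + kappa mu < 1)%E)
    (Bs : seq {set 'I_N}) (hBs : is_cover Bs)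
    (f : config Om -> R) (hfb : bounded_fun f) (hf0 : forall x, 0 <= f x) :
  let C := (1 - fine (gamma mu) - fine (kappa mu))^-1 in
  Ent mu f <=
    C * ((max_block Bs)%:R / (min_deg Bs)%:R) *
      \sum_(B <- Bs) \int[mu]_x Ent (cond_on mu B x) f.
Proof.
have aux (E E' X X' W V : R) :
    E' <= X' -> X' <= X + W -> - V <= E' - E -> E <= X + (V + W) by lra.
rewrite /=; set gam := fine (gamma mu); set kap := fine (kappa mu).
set C := (1 - gam - kap)^-1.
have gk : gam + kap < 1 by exact: fine_gamma_kappa.
have kap0 : 0 <= kap by rewrite fine_ge0// kappa_ge0.
have gam1 : gam < 1 by lra.
have C0 : 0 < C by rewrite invr_gt0; lra.
have [M fM] := bdd_fun_bounded hfb.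
have {}fM x : 0 <= f x <= M.
  by rewrite hf0 (le_trans _ (fM x))// ler_norm.
have M0 : 0 <= M by have /andP[h1 h2] := fM point; exact: le_trans h2.
have n0 : (0 : R) < (min_deg Bs)%:R by rewrite ltr0n min_deg_gt0.
set D := C * _.
have D0 : 0 <= D by rewrite /D mulr_ge0 ?divr_ge0 ?(ltW C0)//.
(* For functions bounded away from zero: tensorization over sites, then monotonicity from a site to
   each block that contains it. *)
have positive g eps L : 0 < eps -> (forall x, eps <= g x <= L) ->
    Ent mu g <= D * \sum_(B <- Bs) \int[mu]_x Ent (cond_on mu B x) g.
  move=> e0 gL.
  have e1 B : 0 <= \int[mu]_x Ent (cond_on mu B x) g.
    by apply: Exp_ge0 => x; exact: Ent_ge0 e0 gL.
  have tens := approximate_tensorization hOm hmu gam1 (heat_bath_decay hOm hmu hN hgk) hlim e0 gL.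
  have mono (B : {set 'I_N}) k : k \in B -> \int[mu]_x Ent (cond_on mu [set k]%SET x) g <=
      \int[mu]_x Ent (cond_on mu B x) g.
    by move=> kB; apply: (mean_Ent_mono hOm hmu e0 gL); rewrite finset.sub1set.
  have := sum_cover_le Bs (fun k => e1 [set k]%SET) e1 mono.
  move: tens; have E0 := Ent_ge0 mu e0 gL.
  set S := \sum_(k < N) _; set Q := \sum_(B <- Bs) _; set E := Ent mu g in E0 *.
  move=> tens blocks.
  have S0 : 0 <= S by apply: sumr_ge0.
  (* Since [kap] and [E] are nonnegative, [(1 - gam - kap) * E <= (1 - gam) * E <= S]. *)
  have CE : E <= C * S.
    rewrite mulrC ler_pdivlMr; last by lra.
    by nra.
  apply: le_trans CE _; rewrite /D -!mulrA; apply: ler_wpM2l; first exact: ltW.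
  by rewrite mulrA mulrAC ler_pdivlMr// mulrC.
(* The constant of [Ent_shift]; it is the same for every measure, so it applies to [mu] and under
   the integral to all conditional measures. *)
pose K := 2 * (2 + M).
have K0 : 0 <= K by rewrite /K mulr_ge0// addr_ge0.
(* With [s = 1 / n], the shift by [s^2] costs [K s] on the left and [K s] for each block on the
   right. *)
apply: (@ler_add_inv_nat _ _ _ (K + D * (\sum_(B <- Bs) K)) 0).
  by rewrite addr_ge0// mulr_ge0// sumr_ge0.
move=> n n_gt0; pose s : R := n%:R^-1.
have s01 : 0 < s <= 1.
  by rewrite /s invr_gt0 ltr0n n_gt0 invf_le1 ?ler1n ?ltr0n.
have /andP[s0 s1] := s01.
have h m : `|Ent m (fun x => f x + s ^+ 2) - Ent m f| <= K * s by exact: Ent_shift fM s01.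
have gL x : s ^+ 2 <= f x + s ^+ 2 <= M + s ^+ 2.
  by have /andP[h1 h2] := fM x; rewrite lerDr h1 lerD2r.
have hp := positive _ _ _ (exprn_gt0 2 s0) gL.
have hB B : \int[mu]_x Ent (cond_on mu B x) (fun x => f x + s ^+ 2) <=
    \int[mu]_x Ent (cond_on mu B x) f + K * s.
  have b1 := bdd_Ent (cond_on mu B) fM.
  have b2 : bdd (fun x => Ent (cond_on mu B x) (fun x => f x + s ^+ 2)).
    apply: (@bdd_Ent _ _ _ _ _ _ (M + s ^+ 2)) => x.
    by rewrite addr_ge0 ?sqr_ge0//= lerD2r; case/andP: (fM x).
  rewrite -(Exp_cst mu (K * s)) -ExpD; [|by bd|by bd].
  by apply: Exp_le; [by bd|by bd|] => x; have := h (cond_on mu B x); rewrite ler_norml; lra.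
have hS : \sum_(B <- Bs) \int[mu]_x Ent (cond_on mu B x) (fun x => f x + s ^+ 2) <=
    \sum_(B <- Bs) \int[mu]_x Ent (cond_on mu B x) f + (\sum_(B <- Bs) K) * s.
  by rewrite mulr_suml -big_split/=; apply: ler_sum => B _; exact: hB.
have hD := ler_wpM2l D0 hS; rewrite mulrDr in hD.
have -> : (K + D * (\sum_(B <- Bs) K)) / n%:R = K * s + D * ((\sum_(B <- Bs) K) * s).
  by rewrite /s; ring.
have := h mu; rewrite ler_norml => /andP[h1 h2].
exact: aux hp hD h1.
Qed.
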